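(* (i) Suppose $m$ is an odd prime and $\mathbb{F}_q$ has odd characteristic and contains a primitive $m$th root of unity $\zeta$. Then the distinct equivalence classes of $\mathbb{F}_q$-linear MRD-codes in $M_{m^2}(\mathbb{F}_q)$ with minimum distance $m^2$, respectively the distinct equivalence classes of $\mathbb{F}_q$-linear MRD-codes $\mathcal{C}_{\sigma,a}$ in $M_m(\mathbb{F}_{q^m})$ with minimum distance $m$, that correspond to the algebras $(\mathbb{F}_{q^m}/\mathbb{F}_q,\sigma,a)$ (with $a\in\mathbb{F}_{q^m}\setminus\mathbb{F}_q$), can be obtained by using the unique cyclic Galois field extension $\mathbb{F}_{q^m}$ of $\mathbb{F}_q$ of degree $m$, choosing a generator $\sigma$ of $\mathrm{Gal}(\mathbb{F}_{q^m}/\mathbb{F}_q)$ and $a\in\mathcal{S}(\mathbb{F}_{q^m})$, with exactly one representative $(\sigma,a)$ for each equivalence class. (ii) Suppose $\mathbb{F}_{q^2}=\mathbb{F}_q(\sqrt{c})$ for some $c\in\mathbb{F}_q^\times\setminus(\mathbb{F}_q^\times)^2$ and $\mathrm{Gal}(\mathbb{F}_{q^2}/\mathbb{F}_q)=\langle\sigma\rangle$. Then the distinct equivalence classes of $\mathbb{F}_q$-linear MRD-codes in $M_4(\mathbb{F}_q)$ with minimum distance $4$, respectively the distinct equivalence classes of $\mathbb{F}_q$-linear MRD-codes $\mathcal{C}_{\sigma,a}$ in $M_2(\mathbb{F}_{q^2})$ with minimum distance $2$, that correspond to the algebras $(\mathbb{F}_{q^2}/\mathbb{F}_q,\sigma,a)$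 (with $a\in\mathbb{F}_{q^2}\setminus\mathbb{F}_q$), can be obtained by choosing $a$ from the set $$\mathcal{S}_2(\mathbb{F}_{q^2})=\{\sqrt{c},\ 1+s\sqrt{c}\mid s\in\mathbb{F}_q^\times/\{\pm1\}\}$$ or, alternatively, from $$\mathcal{S}'(\mathbb{F}_{q^2})=\{t+\sqrt{c}\mid t\in\{0\}\cup\mathbb{F}_q^\times/\{\pm1\}\},$$ with exactly one representative $a$ for each equivalence class.
   Context: For $\sigma$ a generator of $\mathrm{Gal}(\mathbb{F}_{q^m}/\mathbb{F}_q)$ and $a\in\mathbb{F}_{q^m}\setminus\mathbb{F}_q$, $A=(\mathbb{F}_{q^m}/\mathbb{F}_q,\sigma,a)$ is the Petit algebra $R/R(t^m-a)$, $R=\mathbb{F}_{q^m}[t;\sigma]$ the twisted polynomial ring with $tx=\sigma(x)t$: the $\mathbb{F}_q$-vector space of polynomials of degree $<m$ with product $g\circ h$ equal to the remainder $r$ in the right division $gh=q'(t^m-a)+r$, $\deg r<m$. In both cases ($m=2$, and $m$ odd prime with $\zeta\in\mathbb{F}_q$) it is a division algebra of dimension $m^2$ over $\mathbb{F}_q$. Codes: for $x\in A$ right multiplication $R_x(y)=yx$ is $\mathbb{F}_q$-linear, and is $\mathbb{F}_{q^m}$-linear for $A$ viewed as a left $\mathbb{F}_{q^m}$-vector space with basis $1,t,\dots,t^{m-1}$. The matrices of all $R_x$, $x\in A$, with respect to an $\mathbb{F}_q$-basis of $A$ form the $\mathbb{F}_q$-linear MRD-code in $M_{m^2}(\mathbb{F}_q)$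 corresponding to $A$; their matrices $R(x)$ with respect to $1,t,\dots,t^{m-1}$ form the $\mathbb{F}_q$-linear MRD-code $\mathcal{C}_{\sigma,a}=\{R(x)\mid x\in A\}\subset M_m(\mathbb{F}_{q^m})$. Distance is rank distance $d(X,Y)=\mathrm{rank}(X-Y)$. Equivalence is the standard one under which equivalence classes correspond to isotopy classes of the algebras: $\mathcal{C}'=X\mathcal{C}Y$ with $X,Y\in\mathrm{GL}_{m^2}(\mathbb{F}_q)$ for codes in $M_{m^2}(\mathbb{F}_q)$; $\mathcal{C}'=X\mathcal{C}^\rho Y$ with $X,Y\in\mathrm{GL}_m(\mathbb{F}_{q^m})$ and $\rho\in\mathrm{Gal}(\mathbb{F}_{q^m}/\mathbb{F}_q)$ applied entrywise for codes in $M_m(\mathbb{F}_{q^m})$. Here $\mathbb{F}_q^\times/\{\pm1\}$ denotes a fixed set of coset representatives. Definition of $\mathcal{S}(\mathbb{F}_{q^m})$: fix a generator $\sigma$ of $\mathrm{Gal}(\mathbb{F}_{q^m}/\mathbb{F}_q)$. The field $\mathbb{F}_{q^m}$ is the splitting field of some $x^m-b$ with $b\in\mathbb{F}_q^\times\setminus(\mathbb{F}_q^\times)^m$; fix a root $\beta\in\mathbb{F}_{q^m}$ with $\sigma(\beta)=\zeta\beta$. Let $\mathcal{I}$ be the set of nonempty subsets of $\{0,1,\dots,m-1\}$ other than $\{0\}$. For $I\in\mathcal{I}$ with elements $i_0<i_1<\cdots<i_k$, $k\geq1$, let $$\Delta_I=\{(\zeta^{s(i_1-i_0)},\dots,\zeta^{s(i_k-i_0)})\mid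 1\leq s\leq m\}\subset\mathbb{F}_q^{[\times k]}=\mathbb{F}_q^\times\times\cdots\times\mathbb{F}_q^\times\ (k\text{ factors}),$$ write $\mathbb{F}_q^{[\times k]}/\Delta_I$ for a fixed choice of coset representatives, and put $$K(I;1)=\Big\{\beta^{i_0}+\sum_{j=1}^k a_{i_j}\beta^{i_j}\ \Big|\ (a_{i_1},\dots,a_{i_k})\in\mathbb{F}_q^{[\times k]}/\Delta_I\Big\};$$ for $I=\{i_0\}\in\mathcal{I}$ put $K(I;1)=\{\beta^{i_0}\}$. Then $\mathcal{S}(\mathbb{F}_{q^m})=\bigcup_{I\in\mathcal{I}}K(I;1)\subset\mathbb{F}_{q^m}\setminus\mathbb{F}_q$.
   Formalization: In (i), uniqueness of the pair (σ,a) fails, since (σ,a) and (σ^{-1},a^{-1}) give equivalent codes; it is replaced by: for each generator σ exactly one a in S per class, and codes for generators σ, τ are inequivalent unless τ = σ or τ = σ^{-1}. *)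

(* Defs.v *)
From HB Require Import structures.
From mathcomp Require Import all_boot all_order all_algebra.
From mathcomp Require Import all_fingroup all_solvable all_field.

Set Implicit Arguments.
Unset Strict Implicit.
Unset Printing Implicit Defensive.

Import GRing.Theory.
Local Open Scope ring_scope.

(* The twisted polynomial ring K[t; s], with t x = s(x) t, has {poly K} as its
   underlying left K-module, coefficients being written on the left:
   (x t^i) (y t^j) = x s^i(y) t^(i+j). *)
Section TwistedPolynomials.

Variables (K : fieldType) (s : K -> K).
Implicit Types p q f r : {poly K}.

Definition tw_mul p q : {poly K} :=
  \sum_(i < size p) \sum_(j < size q) (p`_i * iter i s q`_j) *: 'X^(i + j).

Fixpoint tw_mod_rec n f p : {poly K} :=
  if n is n'.+1 then
    if (size p < size f)%N then p
    else tw_mod_rec n' f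
           (p - tw_mul (lead_coef p *: 'X^(size p - size f)) f)
  else p.

(* The remainder of p in the right division p = q f + r by a monic f;
   see tw_modP. *)
Definition tw_mod f p : {poly K} := tw_mod_rec (size p) f p.

Lemma tw_mul_widen n p q : (size p <= n)%N ->
  tw_mul p q =
    \sum_(i < n) \sum_(j < size q) (p`_i * iter i s q`_j) *: 'X^(i + j).
Proof.
move=> le_pn; rewrite /tw_mul.
pose G i := \sum_(j < size q) (p`_i * iter i s q`_j) *: 'X^(i + j) : {poly K}.
rewrite -(big_mkord xpredT G) -[RHS](big_mkord xpredT G).
rewrite (big_cat_nat (leq0n _) le_pn) /= [X in _ = _ + X]big_nat.
rewrite [X in _ = _ + X]big1 ?addr0 // => i /andP[le_pi _].
by rewrite /G big1 // => j _; rewrite nth_default // mul0r scale0r.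
Qed.

Lemma tw_mulDl p1 p2 q : tw_mul (p1 + p2) q = tw_mul p1 q + tw_mul p2 q.
Proof.
pose n := maxn (size p1) (size p2).
rewrite (@tw_mul_widen n (p1 + p2)) ?size_polyD //.
rewrite (@tw_mul_widen n p1) ?leq_maxl // (@tw_mul_widen n p2) ?leq_maxr //.
rewrite -big_split; apply: eq_bigr => i _ /=.
rewrite -big_split; apply: eq_bigr => j _ /=.
by rewrite coefD mulrDl scalerDl.
Qed.

Lemma tw_mul0l q : tw_mul 0 q = 0.
Proof. by rewrite /tw_mul size_poly0 big_ord0. Qed.

Lemma tw_mulNl p q : tw_mul (- p) q = - tw_mul p q.
Proof. by apply/eqP; rewrite -addr_eq0 -tw_mulDl addNr tw_mul0l. Qed.

Hypothesis s1 : s 1 = 1.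

Lemma tw_mul_monic p f : f \is monic -> p != 0 ->
  size (tw_mul p f) = (size p + size f).-1 /\
  lead_coef (tw_mul p f) = lead_coef p.
Proof.
move=> fm p0; have f0 := monic_neq0 fm.
have [m sp] : exists m, size p = m.+1.
  by case: (size p) (size_poly_eq0 p) p0 => [<-|m _ _]; [by []|exists m].
have [n sf] : exists n, size f = n.+1.
  by case: (size f) (size_poly_eq0 f) f0 => [<-|n _ _]; [by []|exists n].
have its k : iter k s 1 = 1 by elim: k => //= k ->.
have co k : (tw_mul p f)`_k = \sum_(i < m.+1) \sum_(j < n.+1)
    (p`_i * iter i s f`_j) * (k == i + j)%N%:R.
  rewrite /tw_mul sp sf coef_sum; apply: eq_bigr => i _.
  by rewrite coef_sum; apply: eq_bigr => j _; rewrite coefZ coefXn.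
have top : (tw_mul p f)`_(m + n) = lead_coef p.
  rewrite co (bigD1 ord_max) //= [X in _ + X]big1 ?addr0; last first.
    move=> i ni; rewrite big1 // => j _.
    case: eqP => [e|_]; last by rewrite mulr0.
    have ltim : (i < m)%N by rewrite ltn_neqAle ni -ltnS ltn_ord.
    have := ltn_ord j; rewrite ltnS => lej.
    by have := leq_add ltim lej; rewrite addSn e ltnn.
  rewrite (bigD1 ord_max) //= [X in _ + X]big1 ?addr0; last first.
    move=> j nj; rewrite eqn_add2l eq_sym (_ : (j == n :> nat) = false) ?mulr0 //.
    by apply/negbTE; apply: contra nj => /eqP e; apply/eqP/val_inj.
  rewrite eqxx mulr1.
  have -> : f`_n = 1 by move/monicP: fm; rewrite lead_coefE sf.
  by rewrite its mulr1 lead_coefE sp.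
have le : (size (tw_mul p f) <= (m + n).+1)%N.
  apply/leq_sizeP => k lk; rewrite co big1 // => i _; rewrite big1 // => j _.
  case: eqP => [e|_]; last by rewrite mulr0.
  have := leq_add (ltn_ord i : (i <= m)%N) (ltn_ord j : (j <= n)%N).
  by rewrite -e leqNgt lk.
have nz : (tw_mul p f)`_(m + n) != 0 by rewrite top lead_coef_eq0.
have sz : size (tw_mul p f) = (m + n).+1.
  apply/eqP; rewrite eqn_leq le /= ltnNge; apply: contra nz => h.
  by rewrite nth_default.
by split; [rewrite sz sp sf addnS|rewrite lead_coefE sz /= top].
Qed.

Lemma tw_modP f p : f \is monic ->
  (exists q, p = tw_mul q f + tw_mod f p) /\ (size (tw_mod f p) < size f)%N.
Proof.
move=> fm; have f_gt0 : (0 < size f)%N by rewrite size_poly_gt0 monic_neq0.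
rewrite /tw_mod.
suff main n p' : (size p' <= n)%N ->
    (exists q, p' = tw_mul q f + tw_mod_rec n f p') /\
    (size (tw_mod_rec n f p') < size f)%N by exact: main.
elim: n p' => [|n IHn] {}p.
  rewrite leqn0 size_poly_eq0 => /eqP->; rewrite /= size_poly0 f_gt0.
  by split=> //; exists 0; rewrite tw_mul0l add0r.
move=> le_pn /=; case: ltnP => [lt_pf|le_fp].
  by split=> //; exists 0; rewrite tw_mul0l add0r.
set d := lead_coef p *: _; set p' := p - _.
have p0 : p != 0 by rewrite -size_poly_gt0 (leq_trans f_gt0).
have lp0 : lead_coef p != 0 by rewrite lead_coef_eq0.
have sd : size d = (size p - size f).+1 by rewrite size_scale // size_polyXn.
have d0 : d != 0 by rewrite -size_poly_gt0 sd.
have [sm lm] := tw_mul_monic fm d0.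
have ld : lead_coef d = lead_coef p.
  by rewrite /d lead_coefZ lead_coefXn mulr1.
have sm' : size (tw_mul d f) = size p by rewrite sm sd addSn subnK.
have lt : (size p' < size p)%N.
  have pg : (0 < size p)%N by rewrite size_poly_gt0.
  rewrite -(prednK pg) ltnS; apply/leq_sizeP => k; rewrite leq_eqVlt.
  case/orP => [/eqP<-|lk].
    rewrite coefB -{2}sm' -!lead_coefE lm ld subrr //.
  by rewrite prednK // in lk; rewrite coefB !nth_default ?subrr // ?sm'.
have [|[q eq] szr] := IHn p'.
  by rewrite -ltnS (leq_trans lt).
split=> //; exists (q + d).
by rewrite tw_mulDl addrAC -eq /p' subrK.
Qed.

Lemma tw_mod_uniq f p q r : f \is monic ->
  p = tw_mul q f + r -> (size r < size f)%N -> r = tw_mod f p.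
Proof.
move=> fm ep sr; have [[q' eq'] sr'] := tw_modP p fm.
have e : tw_mul (q - q') f = tw_mod f p - r.
  rewrite tw_mulDl tw_mulNl; apply/eqP.
  by rewrite subr_eq addrAC eq_sym subr_eq eq_sym addrC -eq' ep addrC.
have [/eqP|nz] := eqVneq (q - q') 0.
  rewrite subr_eq0 => /eqP eqq; move: e.
  by rewrite eqq subrr tw_mul0l => /esym/eqP; rewrite subr_eq0 => /eqP.
have [sz _] := tw_mul_monic fm nz.
have : (size (tw_mul (q - q') f) < size f)%N.
  by rewrite e (leq_ltn_trans (size_polyD _ _)) // size_polyN gtn_max sr' sr.
have: (0 < size (q - q')%R)%N by rewrite size_poly_gt0.
by rewrite sz; case: (size (q - q')) => // k _; rewrite addSn /= ltnNge leq_addl.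
Qed.

End TwistedPolynomials.

Section RankMetricCodes.

Definition code (K : fieldType) (n : nat) := 'M[K]_n -> Prop.

Definition has_card (T : eqType) (A : T -> Prop) (N : nat) : Prop :=
  exists s : seq T, [/\ uniq s, size s = N & forall x, x \in s <-> A x].

Variables (K : fieldType) (n : nat).
Implicit Types C D : code K n.

Definition min_rank_distance C (d : nat) : Prop :=
  (forall M N, C M -> C N -> M != N -> (d <= \rank (M - N)%R)%N) /\
  (exists M N, [/\ C M, C N, M != N & \rank (M - N) = d]).

(* Equality in the Singleton-like bound |C| <= |K|^(n (n - d + 1)), for a
   finite field K. *)
Definition is_MRD C (d : nat) : Prop :=
  min_rank_distance C d /\
  exists2 Q, has_card (fun _ : K => True) Q
           & has_card C (Q ^ (n * (n - d + 1)))%N.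

(* Linearity over a field F, along a field embedding iota : F -> K. *)
Definition is_linear_code (F : fieldType) (iota : F -> K) C : Prop :=
  C 0 /\ forall (c : F) M N, C M -> C N -> C (iota c *: M + N).

(* D = X C^rho Y *)
Definition code_transform (X Y : 'M[K]_n) (rho : K -> K) C D : Prop :=
  forall N, D N <-> exists2 M, C M & N = X *m map_mx rho M *m Y.

End RankMetricCodes.

Section PetitAlgebras.

Variables (F : finFieldType) (L : splittingFieldType F) (m : nat).

(* The underlying F-vector space of the algebra (L/F, sigma, a): a twisted
   polynomial of degree < m is given by the family of its coefficients. *)
Definition petit_space : vectType F := {ffun 'I_m -> L}.

Definition petit_poly (x : {ffun 'I_m -> L}) : {poly L} :=
  \sum_(i < m) x i *: 'X^i.

Definition petit_mul (sigma : gal_of {:L}) (a : L)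
    (g h : {ffun 'I_m -> L}) : {ffun 'I_m -> L} :=
  [ffun i : 'I_m =>
     (tw_mod sigma ('X^m - a%:P)
        (tw_mul sigma (petit_poly g) (petit_poly h)))`_i].

(* Matrices act on row vectors, as usual in the library: row i holds the
   coordinates of the image of the i-th basis vector under R_x : y |-> y x. *)
Definition right_mul_mxF (sigma : gal_of {:L}) (a : L)
    (e : (m ^ 2).-tuple petit_space) (x : petit_space) : 'M[F]_(m ^ 2) :=
  \matrix_(i, j) coord e j (petit_mul sigma a (tnth e i) x).

Definition t_pow (i : 'I_m) : {ffun 'I_m -> L} := [ffun j => (j == i)%:R].

Definition right_mul_mxL (sigma : gal_of {:L}) (a : L)
    (x : {ffun 'I_m -> L}) : 'M[L]_m :=
  \matrix_(i, j) petit_mul sigma a (t_pow i) x j.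

Definition corresponds_F (sigma : gal_of {:L}) (a : L)
    (C : code F (m ^ 2)) : Prop :=
  exists2 e : (m ^ 2).-tuple petit_space, basis_of fullv e
    & forall M, C M <-> exists x, M = right_mul_mxF sigma a e x.

Definition corresponds_L (sigma : gal_of {:L}) (a : L)
    (C : code L m) : Prop :=
  forall M, C M <-> exists x, M = right_mul_mxL sigma a x.

Definition equiv_F (n : nat) (C D : code F n) : Prop :=
  exists X Y, [/\ X \in unitmx, Y \in unitmx & code_transform X Y id C D].

Definition equiv_L (n : nat) (C D : code L n) : Prop :=
  exists X Y (rho : gal_of {:L}),
    [/\ X \in unitmx, Y \in unitmx, rho \in 'Gal({:L} / 1%VS)%g
      & code_transform X Y rho C D].

Definition linear_MRD_F (C : code F (m ^ 2)) : Prop :=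
  is_linear_code (id : F -> F) C /\ is_MRD C (m ^ 2).

Definition linear_MRD_L (C : code L m) : Prop :=
  is_linear_code (fun c : F => c%:A : L) C /\ is_MRD C m.

(* The elements of S are outside F and yield codes with the property good;
   and, among all such codes obtained from some a outside F, every equivalence
   class has exactly one representative a in S. *)
Definition represents_classes (K : fieldType) (n : nat)
    (good : code K n -> Prop) (equiv : code K n -> code K n -> Prop)
    (corresponds : L -> code K n -> Prop) (S : L -> Prop) : Prop :=
  (forall a, S a -> a \notin 1%VS /\ forall C, corresponds a C -> good C) /\
  (forall C, good C ->
     (exists2 a, a \notin 1%VS & corresponds a C) ->
     exists! a, S a /\ exists2 D, corresponds a D & equiv C D).

(* The algebras (L/F, sigma, a) and (L/F, sigma^-1, a^-1) are isotopic: in the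
   ring of additive endomorphisms of the first one, left multiplication by
   \sum_i y_i t^i is \sum_i y_i T^i for T the left multiplication by t, and
   (\sum_(i < m) y_i T^i) T^-(m-1) = \sum_(i < m) y_(m-1-i) (T^-1)^i, where
   T^-1 is sigma^-1-semilinear and T^-m maps 1 to a^-1.  So codes can only be
   told apart by sigma up to inversion. *)
Definition separates_generators (K : fieldType) (n : nat)
    (equiv : code K n -> code K n -> Prop)
    (corresponds : gal_of {:L} -> L -> code K n -> Prop)
    (S : L -> Prop) : Prop :=
  forall (sigma tau : gal_of {:L}) a b C D,
    generator 'Gal({:L} / 1%VS)%g sigma -> generator 'Gal({:L} / 1%VS)%g tau ->
    S a -> S b -> corresponds sigma a C -> corresponds tau b D -> equiv C D ->
    tau = sigma \/ tau = (sigma^-1)%g.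

End PetitAlgebras.

Section Representatives.

(* T is a set of representatives of G modulo multiplication by elements of D. *)
Definition coset_reps (W : finType) (mul : W -> W -> W) (G D T : {set W}) :=
  T \subset G /\
  forall u, u \in G -> exists! t, t \in T /\ exists2 d, d \in D & u = mul t d.

Variables (F : finFieldType) (L : splittingFieldType F) (m : nat).

Definition pm1_reps (T : {set F}) : Prop :=
  coset_reps *%R [set x | x != 0] [set 1; -1] T.

(* i_j, for I = {i_0 < i_1 < ... < i_k} with k = #|I| - 1 *)
Definition elt (I : {set 'I_m}) (j : nat) : nat := nth 0%N (map val (enum I)) j.

Lemma elt_incr (I : {set 'I_m}) j1 j2 :
  (j1 < j2 < #|I|)%N -> (elt I j1 < elt I j2)%N.
Proof.
case/andP=> lt12 lt2; have srt : sorted ltn (map val (enum I)).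
  have sub : subseq (map val (enum I)) (iota 0 m).
    by rewrite -val_enum_ord map_subseq // enumT filter_subseq.
  exact: (subseq_sorted ltn_trans sub (iota_ltn_sorted 0 m)).
have sz : size (map val (enum I)) = #|I| by rewrite size_map -cardE.
by apply: (sorted_ltn_nth ltn_trans) => //; rewrite inE sz // (ltn_trans lt12).
Qed.

(* The tuple (x_(i_1), ..., x_(i_k)) is indexed by 'I_k, from 0. *)
Definition coefs (I : {set 'I_m}) : finType := {ffun 'I_#|I|.-1 -> F}.

Definition coefs_mul (I : {set 'I_m}) (u v : coefs I) : coefs I :=
  [ffun j => u j * v j].

Definition coefs_units (I : {set 'I_m}) : {set coefs I} :=
  [set u : coefs I | [forall j, u j != 0]].

Definition Delta (zeta : F) (I : {set 'I_m}) : {set coefs I} :=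
  [set [ffun j : 'I_#|I|.-1 => zeta ^+ (s.+1 * (elt I j.+1 - elt I 0))]
  | s : 'I_m].

Definition Delta_reps (zeta : F) (T : forall I, {set coefs I}) : Prop :=
  forall I : {set 'I_m},
    coset_reps (@coefs_mul I) (coefs_units I) (Delta zeta I) (T I).

(* For #|I| = 1 there are no coefficients, and K(I;1) = {beta^(i_0)}. *)
Definition K1 (beta : L) (I : {set 'I_m}) (TI : {set coefs I}) (x : L) : Prop :=
  exists2 u : coefs I, u \in TI
    & x = beta ^+ elt I 0 + \sum_(j < #|I|.-1) u j *: beta ^+ elt I j.+1.

Definition S_set (beta : L) (T : forall I, {set coefs I}) (x : L) : Prop :=
  exists I : {set 'I_m},
    [/\ I != set0, I != [set i : 'I_m | i == 0%N :> nat] & K1 beta (T I) x].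

Definition S2_set (r : L) (T : {set F}) (x : L) : Prop :=
  x = r \/ exists2 s : F, s \in T & x = 1 + s *: r.

Definition S2'_set (r : L) (T : {set F}) (x : L) : Prop :=
  exists2 t : F, t \in 0 |: T & x = t%:A + r.

End Representatives.

(* Main.v *)
Require Import Defs.
From HB Require Import structures.
From mathcomp Require Import all_boot all_order all_algebra.
From mathcomp Require Import all_fingroup all_solvable all_field.

(** A twisted polynomial of degree less than [m] is its family of
    coefficients, and left multiplication by [t] in the algebra of [(sigma,
    a)] is the [sigma]-semilinear operator [T] that moves coefficients up by
    one place and multiplies the one that wraps around by [a]. Reducing
    monomials gives [g * h = \sum_i g_i T^i h] (petit_mulE), so everything is
    linear algebra with powers of [T], and [T^m] is the diagonal operator with
    entries [a, sigma a, ..., sigma^(m-1) a].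

    When [m] is prime and [a] is not in F these entries are pairwise distinct,
    hence a subspace over L that is stable under [T] is spanned by some of the
    [t^k], and [T] permutes the lines of the [t^k] cyclically: the only stable
    subspaces are the trivial ones. If [g * h = 0] with [g] and [h] nonzero,
    then the multiples [y * h] form a stable subspace, hence everything,
    although [y |-> y * h] is not injective: a contradiction. So the algebra
    is a division algebra (petit_division), which is what makes the codes MRD.

    An equivalence of two codes, of either kind, gives an isotopism [H (x * y)
    = P x * Q y] of the algebras. The operators that preserve the set of left
    multiplications by composition on the left, and those that preserve it by
    composition on the right, are the multiplications by scalars of L: a
    larger power of [T] would lead to [T^m], which is not a scalar
    (left_nucleus, middle_nucleus). Therefore [H] and [Q] are semilinear, and
    comparing the ways in which left multiplication by [t^i] commutes with
    scalars shows that [P] sends [t^i] to a multiple of some [t^(p i)], where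
    [p i] grows by a constant modulo [m]. If it wrapped around at some places
    only, [T^m] would again be a scalar; so [p] is monotone, and a monotone
    arithmetic progression of [m] terms in [0, m) has step 1 or -1. So the
    automorphism is the same up to inversion, [H T H^-1] is [d T] or [d T^-1],
    and its [m]-th power compares [a] with [b] up to a norm and a Galois
    automorphism (isotopic_classification). Conversely, norms from a finite
    field are surjective, and [x_i |-> rho (x_i) N_i(d)] realises every
    relation [rho a = c b] by an isomorphism, where [N_i(d)] is the partial
    norm (petit_iso_mul, pnorm_surj).

    For a fixed automorphism the equivalence classes are thus the orbits of
    [Gal(L/F)] and [F^*] on [L \ F] (for [m = 2] the second alternative gives
    nothing new, because [b^-1] is the conjugate of [b] divided by a norm). In
    the basis of powers of [beta], on which the Galois group is diagonal, an
    element is determined up to [F^*] by its support [I] and by the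
    coefficients that remain once the first one is made 1, and the Galois
    group acts on these by [Delta_I]: this is why [S] meets every orbit
    exactly once (S_set_orbit_reps). The quadratic case is the same with the
    basis [1, r] (S2_orbit_reps, S2'_orbit_reps). *)

Set Implicit Arguments.
Unset Strict Implicit.
Unset Printing Implicit Defensive.

Import GRing.Theory.
Local Open Scope ring_scope.

(** * The product in terms of left multiplication by t *)

Section LeftScaling.

Variables (F : finFieldType) (L : splittingFieldType F) (m : nat).
Local Notation V := {ffun 'I_m -> L}.

(** The operation [*:] on this space is the scaling over F; this one is over L. *)
Definition lscale (l : L) (x : V) : V := [ffun i => l * x i].
Local Notation "l *v x" := (lscale l x) (at level 40).

Lemma lscaleA l1 l2 x : l1 *v (l2 *v x) = (l1 * l2) *v x.
Proof. by apply/ffunP=> i; rewrite !ffunE mulrA. Qed.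

Lemma lscale1 x : 1 *v x = x.
Proof. by apply/ffunP=> i; rewrite !ffunE mul1r. Qed.

Lemma lscale0 x : 0 *v x = 0.
Proof. by apply/ffunP=> i; rewrite !ffunE mul0r. Qed.

Lemma lscalev0 l : l *v 0 = 0.
Proof. by apply/ffunP=> i; rewrite !ffunE mulr0. Qed.

Lemma lscaleDr l x y : l *v (x + y) = l *v x + l *v y.
Proof. by apply/ffunP=> i; rewrite !ffunE mulrDr. Qed.

Lemma lscaleDl l1 l2 x : (l1 + l2) *v x = l1 *v x + l2 *v x.
Proof. by apply/ffunP=> i; rewrite !ffunE mulrDl. Qed.

Lemma lscale_sumr l (I : Type) (r : seq I) (P : pred I) (x : I -> V) :
  l *v (\sum_(i <- r | P i) x i) = \sum_(i <- r | P i) l *v x i.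
Proof. exact: (big_morph _ (lscaleDr l) (lscalev0 l)). Qed.

Lemma sum_t_pow (x : V) : x = \sum_i x i *v t_pow L i.
Proof.
apply/ffunP=> k; rewrite sum_ffunE (bigD1 k) //= big1 => [|i nik].
  by rewrite !ffunE eqxx mulr1 addr0.
by rewrite !ffunE eq_sym (negPf nik) mulr0.
Qed.

Lemma t_pow_neq0 (i : 'I_m) : t_pow L i != 0.
Proof.
by apply/eqP=> /ffunP/(_ i)/eqP; rewrite !ffunE eqxx oner_eq0.
Qed.

End LeftScaling.

Notation "l *v x" := (lscale l x) (at level 40).

Section Shift.

Variables (F : finFieldType) (L : splittingFieldType F) (m : nat).
Variables (sigma : gal_of {:L}) (a : L).
Local Notation V := {ffun 'I_m -> L}.

Definition shift (x : V) : V :=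
  [ffun k : 'I_m => (if k == 0%N :> nat then a else 1) * sigma (x (ord_pred k))].

Lemma shiftD x y : shift (x + y) = shift x + shift y.
Proof. by apply/ffunP=> k; rewrite !ffunE rmorphD mulrDr. Qed.

Lemma shift0 : shift 0 = 0.
Proof. by apply/ffunP=> k; rewrite !ffunE rmorph0 mulr0. Qed.

Lemma shiftZ l x : shift (l *v x) = sigma l *v shift x.
Proof. by apply/ffunP=> k; rewrite !ffunE rmorphM mulrCA. Qed.

Lemma shift_sum (I : Type) (r : seq I) (P : pred I) (x : I -> V) :
  shift (\sum_(i <- r | P i) x i) = \sum_(i <- r | P i) shift (x i).
Proof. exact: (big_morph _ shiftD shift0). Qed.

Lemma iter_shiftD n x y :
  iter n shift (x + y) = iter n shift x + iter n shift y.
Proof. by elim: n => //= n ->; rewrite shiftD. Qed.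

Lemma iter_shift0 n : iter n shift 0 = 0.
Proof. by elim: n => //= n ->; rewrite shift0. Qed.

Lemma iter_shiftZ n l x :
  iter n shift (l *v x) = iter n sigma l *v iter n shift x.
Proof. by elim: n => //= n ->; rewrite shiftZ. Qed.

Lemma iter_shift_sum n (I : Type) (r : seq I) (P : pred I) (x : I -> V) :
  iter n shift (\sum_(i <- r | P i) x i)
  = \sum_(i <- r | P i) iter n shift (x i).
Proof. exact: (big_morph _ (iter_shiftD n) (iter_shift0 n)). Qed.

Lemma shift_t_pow (k : 'I_m) :
  shift (t_pow L k)
  = (if ordS k == 0%N :> nat then a else 1) *v t_pow L (ordS k).
Proof.
apply/ffunP=> j; rewrite !ffunE (can2_eq (@ord_predK m) (@ordSK m)).
have [->|_] := eqVneq j (ordS k); rewrite ?rmorph1 ?rmorph0 ?mulr1 //.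
by rewrite !mulr0.
Qed.

Lemma iter_shift_t_pow0 (i0 k : 'I_m) : i0 = 0%N :> nat ->
  iter k shift (t_pow L i0) = t_pow L k.
Proof.
move=> i00; case: k => k /=; elim: k => [|k IHk] lt_km /=.
  by congr (t_pow L _); apply: val_inj.
rewrite (IHk (ltnW lt_km)) shift_t_pow.
have e : ordS (Ordinal (ltnW lt_km)) = Ordinal lt_km.
  by apply: val_inj; rewrite /= modn_small.
by rewrite e /= lscale1.
Qed.

Lemma iter_shift_m (i0 : 'I_m) : i0 = 0%N :> nat ->
  iter m shift (t_pow L i0) = a *v t_pow L i0.
Proof.
move=> i00; have m_gt0 : (0 < m)%N by apply: leq_ltn_trans (ltn_ord i0).
have lt_m1 : (m.-1 < m)%N by rewrite prednK.
rewrite -[X in iter X](prednK m_gt0) /= (iter_shift_t_pow0 (Ordinal lt_m1)) //.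
rewrite shift_t_pow.
have -> : ordS (Ordinal lt_m1) = i0.
  by apply: val_inj; rewrite /= prednK // modnn i00.
by rewrite i00.
Qed.

End Shift.

Section PetitProduct.

Variables (F : finFieldType) (L : splittingFieldType F) (m : nat).
Variables (sigma : gal_of {:L}) (a : L).
Local Notation V := {ffun 'I_m -> L}.
Local Notation T := (shift sigma a).

Lemma iter_gal0 n : iter n sigma 0 = 0.
Proof. by elim: n => //= n ->; rewrite rmorph0. Qed.

Lemma iter_galN n x : iter n sigma (- x) = - iter n sigma x.
Proof. by elim: n => //= n ->; rewrite rmorphN. Qed.

Lemma iter_gal1 n : iter n sigma 1 = 1.
Proof. by elim: n => //= n ->; rewrite rmorph1. Qed.

Lemma tw_mulE n1 n2 (p q : {poly L}) : (size p <= n1)%N -> (size q <= n2)%N ->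
  tw_mul sigma p q =
    \sum_(i < n1) \sum_(j < n2) (p`_i * iter i sigma q`_j) *: 'X^(i + j).
Proof.
move=> le_p le_q; rewrite (tw_mul_widen sigma q le_p).
apply: eq_bigr => i _.
pose G j := (p`_i * iter i sigma q`_j) *: 'X^(i + j) : {poly L}.
rewrite -(big_mkord xpredT G) -[RHS](big_mkord xpredT G).
rewrite (big_cat_nat (leq0n _) le_q) /= [X in _ = _ + X]big_nat.
rewrite [X in _ = _ + X]big1 ?addr0 // => j /andP[le_j _].
by rewrite /G [q`_j]nth_default // iter_gal0 mulr0 scale0r.
Qed.

Lemma coef_petit_poly (x : V) (i : 'I_m) : (petit_poly x)`_i = x i.
Proof.
rewrite /petit_poly coef_sum (bigD1 i) //= big1 => [|j nji].
  by rewrite coefZ coefXn eqxx mulr1 addr0.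
by rewrite coefZ coefXn eq_sym (negPf (nji : val j != val i)) mulr0.
Qed.

Lemma size_petit_poly (x : V) : (size (petit_poly x) <= m)%N.
Proof.
rewrite /petit_poly; apply: (leq_trans (size_sum _ _ _)).
apply/bigmax_leqP => i _; apply: (leq_trans (size_scale_leq _ _)).
by rewrite size_polyXn.
Qed.

Lemma petit_polyD (x y : V) :
  petit_poly (x + y) = petit_poly x + petit_poly y.
Proof.
rewrite /petit_poly -big_split; apply: eq_bigr => i _.
by rewrite ffunE scalerDl.
Qed.

Lemma petit_poly0 : petit_poly (0 : V) = 0.
Proof. by rewrite /petit_poly big1 // => i _; rewrite ffunE scale0r. Qed.

Lemma petit_poly_t_pow l (i : 'I_m) :
  petit_poly (l *v t_pow L i) = l *: 'X^i.
Proof.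
rewrite /petit_poly (bigD1 i) //= big1 => [|j nji].
  by rewrite !ffunE eqxx mulr1 addr0.
by rewrite !ffunE (negPf nji) mulr0 scale0r.
Qed.

(** This is the one step of the division algorithm that products need: modulo
    left multiples of [t^m - a], the power [t^(k+m)] is [sigma^k(a) t^k]. *)
Lemma tw_mul_monomial c k : (0 < m)%N ->
  tw_mul sigma (c *: 'X^k) ('X^m - a%:P)
  = c *: 'X^(k + m) - (c * iter k sigma a) *: 'X^k.
Proof.
move=> m_gt0; rewrite (@tw_mulE k.+1 m.+1); first last.
- by rewrite size_XnsubC.
- by rewrite (leq_trans (size_scale_leq _ _)) ?size_polyXn.
rewrite (bigD1 ord_max) //= [X in _ + X]big1 ?addr0; last first.
  move=> i ni; rewrite big1 // => j _; rewrite coefZ coefXn.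
  by rewrite (negPf (ni : val i != k)) mulr0 mul0r scale0r.
rewrite coefZ coefXn eqxx mulr1 (bigD1 ord_max) //= (bigD1 ord0) /=; last first.
  by rewrite -val_eqE /= eq_sym -lt0n.
rewrite [X in _ + (_ + X)]big1 ?addr0; last first.
  move=> j /andP[jm j0]; rewrite coefB coefXn coefC.
  rewrite (negPf (jm : val j != m)) (negPf (j0 : val j != 0%N)) subr0.
  by rewrite iter_gal0 mulr0 scale0r.
rewrite !coefB !coefXn !coefC eqxx (negPf (lt0n_neq0 m_gt0)) eq_sym.
rewrite (negPf (lt0n_neq0 m_gt0)) eqxx subr0 sub0r iter_gal1 iter_galN.
by rewrite mulr1 mulrN scaleNr addn0.
Qed.

(** The remainder is unique and additive in the dividend, so it can be computed
    monomial by monomial; [t^(i+j)] reduces to [T^i (t^j)] even when [i + j]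
    reaches [m]. *)
Theorem petit_mulE (g h : V) :
  petit_mul sigma a g h = \sum_i g i *v iter i T h.
Proof.
case: (posnP m) => [m0|m_gt0].
  by apply/ffunP=> i; have := ltn_ord i; rewrite {2}m0.
pose i0 := Ordinal m_gt0; pose e n := iter n T (t_pow L i0).
pose f := 'X^m - a%:P : {poly L}.
have fm : f \is monic by rewrite monicXnsubC.
have red c n : (n < m + m)%N ->
    exists d, c *: 'X^n = tw_mul sigma d f + petit_poly (c *v e n).
  case: (ltnP n m) => [lt_nm _|le_mn lt_n].
    exists 0; rewrite tw_mul0l add0r /e.
    rewrite (iter_shift_t_pow0 sigma a (Ordinal lt_nm) (erefl : i0 = 0%N :> nat)).
    by rewrite petit_poly_t_pow.
  have lt_k : (n - m < m)%N by rewrite ltn_subLR.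
  exists (c *: 'X^(n - m)); rewrite tw_mul_monomial // subnK //.
  rewrite /e -(subnK le_mn) iterD iter_shift_m // iter_shiftZ addnK.
  rewrite (iter_shift_t_pow0 sigma a (Ordinal lt_k) (erefl : i0 = 0%N :> nat)).
  by rewrite lscaleA petit_poly_t_pow /= subrK.
have redS (I : Type) (r : seq I) (p : I -> {poly L}) (x : I -> V) :
    (forall i, exists d, p i = tw_mul sigma d f + petit_poly (x i)) ->
    exists d, \sum_(i <- r) p i
      = tw_mul sigma d f + petit_poly (\sum_(i <- r) x i).
  move=> cong; elim: r => [|i r [d ed]].
    by exists 0; rewrite !big_nil tw_mul0l petit_poly0 addr0.
  have [d' ed'] := cong i; exists (d' + d).
  by rewrite !big_cons ed ed' petit_polyD tw_mulDl addrACA.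
have [d ed] : exists d, tw_mul sigma (petit_poly g) (petit_poly h)
    = tw_mul sigma d f
      + petit_poly (\sum_(i < m) \sum_(j < m) (g i * iter i sigma (h j)) *v e (i + j)%N).
  rewrite (@tw_mulE m m) ?size_petit_poly //.
  apply: (redS) => i; apply: (redS) => j; rewrite !coef_petit_poly.
  by apply: red; rewrite -addnS leq_add // ltnW.
have := tw_mod_uniq (rmorph1 _) fm ed; rewrite size_XnsubC // ltnS size_petit_poly.
move=> /(_ isT) def_mod; apply/ffunP=> k; rewrite ffunE -def_mod coef_petit_poly.
congr (_ _ k); apply: eq_bigr => i _; rewrite [in RHS](sum_t_pow h).
rewrite iter_shift_sum lscale_sumr; apply: eq_bigr => j _.
rewrite iter_shiftZ lscaleA /e iterD; congr (_ *v iter i T _).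
exact: iter_shift_t_pow0.
Qed.

End PetitProduct.

(** * Linearity of the product, and the Galois group *)

Section PetitProductTheory.

Variables (F : finFieldType) (L : splittingFieldType F) (m : nat).
Variables (sigma : gal_of {:L}) (a : L).
Local Notation V := {ffun 'I_m -> L}.
Local Notation T := (shift sigma a).
Local Notation "x ** y" := (@petit_mul F L m sigma a x y) (at level 40).

Lemma petit_mul0l h : 0 ** h = 0.
Proof. by rewrite petit_mulE big1 // => i _; rewrite ffunE lscale0. Qed.

Lemma petit_mulDl g1 g2 h : (g1 + g2) ** h = g1 ** h + g2 ** h.
Proof.
rewrite !petit_mulE -big_split; apply: eq_bigr => i _.
by rewrite ffunE lscaleDl.
Qed.

Lemma petit_mulZl l g h : (l *v g) ** h = l *v (g ** h).
Proof.
rewrite !petit_mulE lscale_sumr; apply: eq_bigr => i _.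
by rewrite ffunE lscaleA.
Qed.

Lemma petit_mul_suml h (I : Type) (r : seq I) (P : pred I) (x : I -> V) :
  (\sum_(i <- r | P i) x i) ** h = \sum_(i <- r | P i) x i ** h.
Proof.
exact: (big_morph (fun y : V => y ** h)
  (fun x y : V => petit_mulDl x y h) (petit_mul0l h)).
Qed.

Lemma petit_mulDr g h1 h2 : g ** (h1 + h2) = g ** h1 + g ** h2.
Proof.
rewrite !petit_mulE -big_split; apply: eq_bigr => i _ /=.
by rewrite iter_shiftD lscaleDr.
Qed.

Lemma petit_mul_t_pow (i : 'I_m) h : t_pow L i ** h = iter i T h.
Proof.
rewrite petit_mulE (bigD1 i) //= big1 => [|j nji].
  by rewrite ffunE eqxx lscale1 addr0.
by rewrite ffunE (negPf nji) lscale0.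
Qed.

Lemma petit_mulx1 (i0 : 'I_m) : i0 = 0%N :> nat -> forall g, g ** t_pow L i0 = g.
Proof.
move=> i00 g; rewrite petit_mulE [RHS]sum_t_pow.
by apply: eq_bigr => i _; rewrite iter_shift_t_pow0.
Qed.

Lemma petit_scaleE (c : F) (x : V) :
  (c *: (x : petit_space L m) : V) = c%:A *v x.
Proof. by apply/ffunP=> i; rewrite !ffunE mulr_algl. Qed.

Lemma gal_alg (c : F) : sigma c%:A = c%:A :> L.
Proof. by rewrite linearZ rmorph1. Qed.

Lemma iter_gal n x : iter n sigma x = (sigma ^+ n)%g x.
Proof.
elim: n => [|n IHn]; first by rewrite gal_id.
by rewrite iterS IHn expgSr galM ?memvf.
Qed.

Lemma iter_gal_neq0 n (x : L) : x != 0 -> iter n sigma x != 0.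
Proof. by move=> x0; rewrite iter_gal fmorph_eq0. Qed.

Lemma petit_scaler (c : F) g h : g ** (c%:A *v h) = c%:A *v (g ** h).
Proof.
rewrite !petit_mulE lscale_sumr; apply: eq_bigr => i _.
rewrite iter_shiftZ !lscaleA mulrC; congr ((_ * _) *v _).
by rewrite iter_gal linearZ rmorph1.
Qed.

(** Since [t^k = T^k 1], applying [T^m] to it gives
    [T^k (T^m 1) = T^k (a 1) = sigma^k(a) t^k]. *)
Lemma iter_m_shift (x : V) (k : 'I_m) : (sigma ^+ m = 1)%g ->
  iter m T x k = iter k sigma a * x k.
Proof.
move=> sm; have m_gt0 : (0 < m)%N by apply: leq_ltn_trans (ltn_ord k).
pose i0 := Ordinal m_gt0.
rewrite [x in LHS]sum_t_pow iter_shift_sum.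
rewrite (eq_bigr (fun i : 'I_m => (iter i sigma a * x i) *v t_pow L i)).
  rewrite [in RHS](sum_t_pow x) !sum_ffunE mulr_sumr.
  apply: eq_bigr => i _; rewrite !ffunE; case: (k =P i) => [->|_].
    by rewrite !mulr1.
  by rewrite !mulr0.
move=> i _; rewrite iter_shiftZ iter_gal sm gal_id.
rewrite -(iter_shift_t_pow0 sigma a i (erefl : i0 = 0%N :> nat)).
by rewrite -iterD addnC iterD iter_shift_m // iter_shiftZ lscaleA mulrC.
Qed.

End PetitProductTheory.

(** A finite-dimensional space over a finite field is finite. *)
Lemma vect_surj_inj (F : finFieldType) (V : vectType F) (f : V -> V) :
  (forall y, exists x, f x = y) -> injective f.
Proof.
move=> surj; have /fin_all_exists[r rK] : forall y : finvect_type V,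
  exists x : finvect_type V, f x = y by [].
have rI : injective r by move=> x y e; rewrite -(rK x) e.
have [g _ gK] := injF_bij rI.
by move=> x y; rewrite -(gK x) -(gK y) !rK => ->.
Qed.

Section CyclicGalois.

Variables (F : finFieldType) (L : splittingFieldType F) (m : nat).
Variables (sigma : gal_of {:L}) (a : L).
Hypothesis dimL : \dim {:L} = m.
Hypothesis gen_sigma : generator 'Gal({:L} / 1%VS)%g sigma.

Lemma gal_cycle : ('Gal({:L} / 1%VS) = <[sigma]>)%g.
Proof. exact/eqP. Qed.

Lemma mem_galT (rho : gal_of {:L}) : rho \in 'Gal({:L} / 1%VS)%g.
Proof. by rewrite gal_kHom ?sub1v // k1AHom. Qed.

Lemma order_generator : #[sigma]%g = m.
Proof.
rewrite /order -gal_cycle -galois_dim ?finField_galois ?sub1v //.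
by rewrite dimv1 divn1.
Qed.

Lemma expg_m : (sigma ^+ m = 1)%g.
Proof. by rewrite -order_generator expg_order. Qed.

Lemma gal_expg (rho : gal_of {:L}) : exists2 i, (i < m)%N & rho = (sigma ^+ i)%g.
Proof.
have := mem_galT rho; rewrite gal_cycle => /cyclePmin[i].
by rewrite order_generator; exists i.
Qed.

Lemma mem1v_gal : (a \in 1%VS) = (sigma a == a).
Proof.
apply/idP/eqP => [/vlineP[c ->]|fix_a]; first exact: gal_alg.
rewrite -(galois_fixedField (finField_galois (sub1v {:L}))).
apply/fixedFieldP; first exact: memvf.
rewrite gal_cycle => _ /cycleP[i ->]; rewrite -iter_gal.
by elim: i => //= i ->.
Qed.

Lemma gal_neq : a \notin 1%VS -> sigma a != a.
Proof. by rewrite mem1v_gal. Qed.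

(** An equality of two conjugates makes [a] fixed by a nontrivial power of
    [sigma], which generates the whole group because its order is prime. *)
Lemma gal_iter_inj (i j : nat) : prime m -> a \notin 1%VS ->
  (i < m)%N -> (j < m)%N -> iter i sigma a = iter j sigma a -> i = j.
Proof.
move=> pr_m na; wlog lt_ij : i j / (i < j)%N => [wlt lt_i lt_j e|].
  by case: (ltngtP i j) => // lt_ij; [|symmetry]; apply: wlt.
move=> lt_i lt_j; rewrite -{1}(subnKC (ltnW lt_ij)) iterD => e.
have {}e : (sigma ^+ (j - i))%g a = a.
  apply: (fmorph_inj (sigma ^+ i)%g).
  by rewrite -[LHS]iter_gal -[RHS]iter_gal -iter_gal e.
have ltd : (0 < j - i < m)%N.
  by rewrite subn_gt0 lt_ij (leq_ltn_trans (leq_subr _ _)).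
have cop : coprime (j - i) m.
  rewrite coprime_sym prime_coprime //; apply/negP => /dvdn_leq.
  by case/andP: ltd => -> ltd /(_ isT); rewrite leqNgt ltd.
have gen' : generator 'Gal({:L} / 1%VS)%g (sigma ^+ (j - i))%g.
  rewrite /generator gal_cycle -[_ == _]/(generator _ _) generator_coprime.
  by rewrite order_generator coprime_sym.
have fix1 n : ((sigma ^+ (j - i)) ^+ n)%g a = a.
  by rewrite -iter_gal; elim: n => //= n ->.
case/negP: na; rewrite mem1v_gal.
have : sigma \in <[sigma ^+ (j - i)]>%g by rewrite -(eqP gen') mem_galT.
by case/cycleP=> n {1}->; rewrite fix1.
Qed.

End CyclicGalois.

(** * Absence of zero divisors *)

Section Division.

Variables (F : finFieldType) (L : splittingFieldType F) (m : nat).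
Variables (sigma : gal_of {:L}) (a : L).
Hypothesis dimL : \dim {:L} = m.
Hypothesis gen_sigma : generator 'Gal({:L} / 1%VS)%g sigma.
Hypothesis prime_m : prime m.
Hypothesis a_notin : a \notin 1%VS.
Local Notation V := {ffun 'I_m -> L}.
Local Notation T := (shift sigma a).
Local Notation "x ** y" := (@petit_mul F L m sigma a x y) (at level 40).

Lemma notin1_neq0 : a != 0.
Proof. by apply: contraNneq a_notin => ->; apply: mem0v. Qed.

(** The operators [T^m - sigma^l(a)] preserve [W] and are diagonal; applying those
    with [l != k] to [h] leaves a nonzero multiple of [t^k], and then [T] brings
    it to all the other powers of [t]. *)
Lemma shift_stable_total (W : V -> Prop) (h : V) :
  (forall x y, W x -> W y -> W (x + y)) -> (forall l x, W x -> W (l *v x)) ->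
  (forall x, W x -> W (T x)) -> W h -> h != 0 -> forall x, W x.
Proof.
move=> WD WZ WT Wh h0.
have WTn n x : W x -> W (iter n T x) by move=> Wx; elim: n => //= n; apply: WT.
have [k hk] : exists k, h k != 0.
  apply/existsP; apply: contraNT h0; rewrite negb_exists => /forallP h0.
  by apply/eqP/ffunP=> i; rewrite ffunE; apply/eqP; rewrite -[_ == _]negbK h0.
have elim_coefs (s : seq 'I_m) : exists2 y, W y &
    forall j, y j = h j * \prod_(l <- s) (iter j sigma a - iter l sigma a).
  elim: s => [|l s [y Wy def_y]].
    by exists h => // j; rewrite big_nil mulr1.
  exists (iter m T y + (- iter l sigma a) *v y); first by apply: WD; auto.
  move=> j; rewrite ffunE iter_m_shift ?expg_m // ffunE def_y big_cons.
  by rewrite -mulrDl mulrCA.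
have [y Wy def_y] := elim_coefs [seq l <- enum 'I_m | l != k].
have yk : y k != 0.
  rewrite def_y mulf_neq0 // prodf_seq_neq0; apply/allP => l.
  rewrite mem_filter => /andP[nlk _]; apply/implyP => _.
  rewrite subr_eq0; apply: contra nlk => /eqP e; apply/eqP/val_inj/esym.
  exact: (gal_iter_inj dimL gen_sigma prime_m a_notin (ltn_ord k) (ltn_ord l) e).
have We : W (t_pow L k).
  have -> : t_pow L k = (y k)^-1 *v y; last by apply: WZ.
  apply/ffunP=> j; rewrite !ffunE; case: eqP => [->|/eqP njk].
    by rewrite mulVf.
  rewrite (def_y j); set p := \prod_(l <- _) _.
  have -> : p = 0; last by rewrite !mulr0.
  apply/eqP; rewrite prodf_seq_eq0; apply/hasP; exists j => /=; last by rewrite subrr.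
  by rewrite mem_filter njk mem_enum.
have m_gt0 : (0 < m)%N := prime_gt0 prime_m.
pose i0 := Ordinal m_gt0; have i00 : i0 = 0%N :> nat by [].
have We0 : W (t_pow L i0).
  have -> : t_pow L i0 = a^-1 *v (iter (m - k) T (t_pow L k)).
    rewrite -(iter_shift_t_pow0 sigma a k i00) -iterD subnK 1?ltnW //.
    by rewrite iter_shift_m // lscaleA mulVf ?lscale1 ?notin1_neq0.
  by apply: WZ; apply: WTn.
have W0 : W 0 by rewrite -(lscale0 h); apply: WZ.
move=> x; rewrite [x]sum_t_pow; elim/big_rec: _ => // i z _ Wz.
by apply: WD => //; apply: WZ; rewrite -(iter_shift_t_pow0 sigma a i i00); auto.
Qed.

(** The degree of a twisted polynomial. *)
Lemma exists_top (g : V) : g != 0 ->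
  exists2 i : 'I_m, g i != 0 & forall l : 'I_m, (i < l)%N -> g l = 0.
Proof.
move=> g0; have [k gk] : exists k, g k != 0.
  apply/existsP; apply: contraNT g0; rewrite negb_exists => /forallP g0.
  by apply/eqP/ffunP=> i; rewrite ffunE; apply/eqP; rewrite -[_ == _]negbK g0.
have [i gi imax] := @arg_maxnP _ k (fun i => g i != 0) (fun i => i : nat) gk.
exists i => // l lt_il.
apply/eqP; apply: contraTT lt_il => gl; rewrite -leqNgt; exact: imax.
Qed.

(** If [g] kills [h] on the left, then the multiples [y * h] form a subspace
    stable under [T], hence everything.  So [y |-> y * h] is surjective, and
    therefore injective, which leaves only [g = 0]. *)
Theorem petit_division g h : g ** h = 0 -> g = 0 \/ h = 0.
Proof.
move=> gh0; case: (eqVneq h 0) => [|h0]; first by right.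
left; apply/eqP; apply: contraT => g0.
have [d gd dmax] := exists_top g0.
pose W x := exists y, x = y ** h.
have WD x y : W x -> W y -> W (x + y).
  by case=> x' -> [y' ->]; exists (x' + y'); rewrite petit_mulDl.
have WZ l x : W x -> W (l *v x).
  by case=> x' ->; exists (l *v x'); rewrite petit_mulZl.
have W0 : W 0 by exists 0; rewrite petit_mul0l.
have Wlt n : (n < m)%N -> W (iter n T h).
  by move=> lt_nm; exists (t_pow L (Ordinal lt_nm)); rewrite petit_mul_t_pow.
have Wsum (P : pred 'I_m) (x : 'I_m -> V) : (forall i, P i -> W (x i)) ->
    W (\sum_(i | P i) x i).
  by move=> Wx; elim/big_rec: _ => // i y Pi Wy; apply: WD => //; apply: Wx.
(* Multiplying the relation by t^(m-d) expresses T^m h by lower powers. *)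
have Wm : W (iter m T h).
  have := iter_shift0 m sigma a (m - d); rewrite -{1}gh0 petit_mulE.
  rewrite iter_shift_sum (bigD1 d) //= iter_shiftZ -iterD subnK 1?ltnW //.
  set c := iter _ _ _; set z := \sum_(i < m | _) _ => rel.
  have c0 : c != 0 by apply: iter_gal_neq0.
  have -> : iter m T h = (- c^-1) *v z.
    rewrite -[LHS]lscale1 -(mulVf c0) -lscaleA; move/eqP: rel.
    rewrite addr_eq0 => /eqP->; apply/ffunP=> j.
    by rewrite !ffunE mulrN mulNr.
  apply/WZ/Wsum => i nid; rewrite iter_shiftZ -iterD.
  have [/dmax->|le_id] := ltnP d i; first by rewrite iter_gal0 lscale0.
  apply/WZ/Wlt; rewrite -ltn_subRL subKn; last exact: ltnW.
  by rewrite ltn_neqAle le_id andbT.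
have WTlt n : (n <= m)%N -> W (iter n T h).
  by rewrite leq_eqVlt => /predU1P[->|/Wlt].
have WT x : W x -> W (T x).
  case=> y ->; rewrite petit_mulE shift_sum; apply: Wsum => i _.
  by rewrite shiftZ -iterS; apply/WZ/WTlt.
have Wh : W h by apply: (Wlt 0%N); apply: prime_gt0.
have surj y : exists x, x ** h = y.
  by have [x ->] := shift_stable_total WD WZ WT Wh h0 y; exists x.
have inj := @vect_surj_inj F (petit_space L m) (fun x : V => x ** h) surj.
by case/eqP: g0; apply: (inj g 0); rewrite gh0 petit_mul0l.
Qed.

End Division.

(** * Partial norms, and nuclei of the algebras *)

Section PartialNorm.

Variables (F : finFieldType) (L : splittingFieldType F) (sigma : gal_of {:L}).

(** [(d t)^n = pnorm n d t^n] in the twisted polynomial ring; for [n = m] this is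
    the norm of [d]. *)
Definition pnorm n (d : L) : L := \prod_(j < n) iter j sigma d.

Lemma pnorm0 d : pnorm 0 d = 1.
Proof. by rewrite /pnorm big_ord0. Qed.

Lemma pnormSr n d : pnorm n.+1 d = pnorm n d * iter n sigma d.
Proof. by rewrite /pnorm big_ord_recr. Qed.

Lemma pnormS n d : pnorm n.+1 d = d * sigma (pnorm n d).
Proof.
rewrite /pnorm big_ord_recl; congr (_ * _); rewrite rmorph_prod.
by apply: eq_bigr.
Qed.

Lemma pnorm_neq0 n d : d != 0 -> pnorm n d != 0.
Proof. by move=> d0; apply/prodf_neq0 => j _; apply: iter_gal_neq0. Qed.

Variable m : nat.
Hypothesis dimL : \dim {:L} = m.
Hypothesis gen_sigma : generator 'Gal({:L} / 1%VS)%g sigma.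

(** The two recurrences for partial norms give [d sigma(N) = N sigma^m(d) = N d]
    for the norm [N] of [d]. *)
Lemma pnorm_in1 d : pnorm m d \in 1%VS.
Proof.
rewrite (mem1v_gal _ gen_sigma); have [->|d0] := eqVneq d 0.
  case: (m) => [|n]; first by rewrite pnorm0 rmorph1.
  by rewrite pnormS mul0r rmorph0.
apply/eqP/(mulfI d0); rewrite -pnormS pnormSr mulrC.
by rewrite iter_gal (expg_m dimL gen_sigma) gal_id.
Qed.

End PartialNorm.

Section Semilinear.

Variables (F : finFieldType) (L : splittingFieldType F) (m : nat).
Local Notation V := {ffun 'I_m -> L}.

(** Only the existence of the scalars [c] is assumed; reading them off at a
    preimage of a basis vector shows that they depend on [l] through a ring morphism
    over F. *)
Lemma semilinear_gal (H : V -> V) (i0 : 'I_m) :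
  (forall x y, H (x + y) = H x + H y) ->
  (forall (c : F) x, H (c%:A *v x) = c%:A *v H x) ->
  (forall y, exists x, H x = y) ->
  (forall l, exists c, forall x, H (l *v x) = c *v H x) ->
  exists rho : gal_of {:L}, forall l x, H (l *v x) = rho l *v H x.
Proof.
move=> HD HF Hsurj Hsemi; have [x0 Hx0] := Hsurj (t_pow L i0).
pose r l := H (l *v x0) i0.
have rE l x : H (l *v x) = r l *v H x.
  have [c Hc] := Hsemi l; rewrite Hc; congr (_ *v _).
  by rewrite /r Hc Hx0 !ffunE eqxx mulr1.
have rI k l : k *v t_pow L i0 = l *v t_pow L i0 -> k = l.
  by move/ffunP/(_ i0); rewrite !ffunE eqxx !mulr1.
have r_lin : linear r.
  move=> c x y; rewrite /r -mulr_algl lscaleDl HD -lscaleA HF.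
  by rewrite !ffunE mulr_algl.
have rM : {morph r : x y / x * y}.
  by move=> x y; apply: rI; rewrite -Hx0 -rE -!lscaleA !rE lscaleA.
have r1 : r 1 = 1 by rewrite /r lscale1 Hx0 ffunE eqxx.
pose rL : {linear L -> L} := HB.pack r (GRing.isLinear.Build F L L _ r r_lin).
have /kAut_to_gal[rho _ rho_r] : kAut 1 {:L} (linfun rL).
  rewrite kAutfE; apply/kHomP_tmp.
  split=> [x /vlineP[c ->] | x y _ _]; rewrite !lfunE //=.
  by rewrite -[r _]/(rL _) linearZ /= r1.
by exists rho => l x; rewrite rE -rho_r ?memvf // lfunE.
Qed.

End Semilinear.

Section Nuclei.

Variables (F : finFieldType) (L : splittingFieldType F) (m : nat).
Variables (tau : gal_of {:L}) (b : L).
Hypothesis dimL : \dim {:L} = m.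
Hypothesis gen_tau : generator 'Gal({:L} / 1%VS)%g tau.
Hypothesis m_gt1 : (1 < m)%N.
Hypothesis b_notin : b \notin 1%VS.
Local Notation V := {ffun 'I_m -> L}.
Local Notation T := (shift tau b).
Local Notation "x ** y" := (@petit_mul F L m tau b x y) (at level 40).

Variable i0 : 'I_m.
Hypothesis i00 : i0 = 0%N :> nat.

Lemma iter_m_shift_not_scalar (c d : L) :
  (forall z : V, c *v iter m T z = d *v z) -> c = 0.
Proof.
move=> scal; pose i1 := Ordinal m_gt1.
have comp (i : 'I_m) : c * iter i tau b = d.
  have /ffunP/(_ i) := scal (t_pow L i).
  by rewrite 2!ffunE iter_m_shift ?(expg_m dimL) // !ffunE eqxx !mulr1.
have /eqP := comp i1; rewrite -(comp i0) i00 /= -subr_eq0 -mulrBr mulf_eq0.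
by rewrite subr_eq0 (negPf (gal_neq gen_tau b_notin)) orbF => /eqP.
Qed.

(** In the sum of [w_l T^(l + m - i) z] the terms with [l < i] are products by
    reduced powers of [t], so they cancel and leave [w_i T^m z = w_i b z]. *)
Lemma top_coef_eq0 (w : V) (i : 'I_m) : i != 0%N :> nat ->
  (forall l : 'I_m, (i < l)%N -> w l = 0) ->
  (forall z, \sum_l w l *v iter (l + (m - i)) T z
             = (\sum_l w l *v iter (l + (m - i)) T (t_pow L i0)) ** z) ->
  w i = 0.
Proof.
move=> ni0 top rel; apply: (@iter_m_shift_not_scalar _ (w i * b)) => z.
have := rel z; rewrite petit_mul_suml (bigD1 i) //= [in RHS](bigD1 i) //=.
rewrite (eq_bigr (fun l : 'I_m =>
  (w l *v iter (l + (m - i)) T (t_pow L i0)) ** z)) => [/addIr|l nil].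
  rewrite subnKC 1?ltnW // iter_shift_m // !petit_mulZl.
  by rewrite (@petit_mul_t_pow _ _ _ tau b i0) i00 /= lscaleA.
have [/top->|le_li] := ltnP i l; first by rewrite !lscale0 petit_mul0l.
have lt_m : (l + (m - i) < m)%N.
  by rewrite addnC -ltn_subRL subKn 1?ltn_neqAle ?nil // ltnW.
rewrite petit_mulZl (iter_shift_t_pow0 tau b (Ordinal lt_m) i00).
by rewrite petit_mul_t_pow.
Qed.

Lemma eq_scalar_top (w : V) :
  (forall i : 'I_m, i != 0%N :> nat ->
     (forall l : 'I_m, (i < l)%N -> w l = 0) -> w i = 0) ->
  w = w i0 *v t_pow L i0.
Proof.
move=> top; have [->|/exists_top[i wi imax]] := eqVneq w 0.
  by rewrite ffunE lscale0.
have i_0 : i = 0%N :> nat.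
  by apply/eqP; apply: contraNT wi => ni0; apply/eqP/top.
have ii0 : i = i0 by apply: val_inj; rewrite /= i_0.
apply/ffunP=> l; rewrite !ffunE; case: eqP => [->|nl]; first by rewrite mulr1.
rewrite mulr0; apply: imax; rewrite i_0 lt0n; apply/eqP => l0; apply: nl.
by apply: val_inj; rewrite /= l0.
Qed.

(** For [H] the identity, this says that an operator whose composites with all
    left multiplications are again left multiplications is a scalar.  The
    general form applies to [H o l o H^-1] without naming the inverse of [H].
    The operator is left multiplication by its value [w] at 1, and composing it
    with multiplication by [t^(m-i)], for [i] the degree of [w], forces [i = 0]. *)
Lemma left_nucleus (H N : V -> V) : (forall z, exists y, H y = z) ->
  (forall g, exists g', forall y z, H y = g ** z -> N y = g' ** z) ->
  exists c, forall y, N y = c *v H y.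
Proof.
move=> Hsurj idl; have [w def_w] := idl (t_pow L i0).
have {}def_w y : N y = w ** H y.
  by apply: def_w; rewrite petit_mul_t_pow i00.
exists (w i0) => y; rewrite def_w {1}[w]eq_scalar_top.
  by rewrite petit_mulZl petit_mul_t_pow i00.
move=> i ni0 top; apply: (top_coef_eq0 ni0 top) => z.
have lt_m : (m - i < m)%N by rewrite ltn_subrL lt0n ni0 ltnW.
have [g' def_g'] := idl (t_pow L (Ordinal lt_m)).
have {}def_g' z' : \sum_l w l *v iter (l + (m - i)) T z' = g' ** z'.
  have [y' Hy'] := Hsurj (t_pow L (Ordinal lt_m) ** z').
  rewrite -(def_g' y' z') // def_w Hy' petit_mulE petit_mul_t_pow.
  by apply: eq_bigr => l _; rewrite iterD.
by rewrite !def_g' (petit_mulx1 tau b i00).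
Qed.

(** The mirror image of left_nucleus, for composition on the other side. *)
Lemma middle_nucleus (Q N : V -> V) : (forall z, exists y, Q y = z) ->
  (forall g, exists g', forall y, g ** N y = g' ** Q y) ->
  exists c, forall y, N y = c *v Q y.
Proof.
move=> Qsurj idl; have [w def_w] := idl (t_pow L i0).
have {}def_w y : N y = w ** Q y.
  by rewrite -def_w petit_mul_t_pow i00.
exists (w i0) => y; rewrite def_w {1}[w]eq_scalar_top.
  by rewrite petit_mulZl petit_mul_t_pow i00.
move=> i ni0 top.
pose w' : V := [ffun l => iter (m - i) tau (w l)].
suff /eqP : w' i = 0.
  by rewrite ffunE => wi0; apply/eqP; apply: contraTT wi0; apply: iter_gal_neq0.
apply: (top_coef_eq0 ni0) => [l /top w0|z].
  by rewrite ffunE w0 iter_gal0.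
have lt_m : (m - i < m)%N by rewrite ltn_subrL lt0n ni0 ltnW.
have [g' def_g'] := idl (t_pow L (Ordinal lt_m)).
have {}def_g' z' : \sum_l w' l *v iter (l + (m - i)) T z' = g' ** z'.
  have [y' <-] := Qsurj z'.
  rewrite -def_g' def_w petit_mul_t_pow petit_mulE iter_shift_sum.
  by apply: eq_bigr => l _; rewrite ffunE iter_shiftZ addnC iterD.
by rewrite !def_g' (petit_mulx1 tau b i00).
Qed.

End Nuclei.

(** * Isotopisms *)

(** The second alternative comes from the isotopism that exchanges [t] with
    its inverse, a semilinear operator for [sigma^-1] whose [m]-th power sends
    1 to [a^-1].  Clearing denominators gives it the same shape as the first
    one. *)
Definition isotopy_condition (F : finFieldType) (L : splittingFieldType F)
    (sigma : gal_of {:L}) (a : L) (tau : gal_of {:L}) (b : L) : Prop :=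
  (tau = sigma /\
     exists rho : gal_of {:L}, exists c : F, rho a = c *: b) \/
  (tau = (sigma^-1)%g /\
     exists rho : gal_of {:L}, exists c : F, rho a * b = c%:A).

Section Isotopisms.

Variables (F : finFieldType) (L : splittingFieldType F) (m : nat).
Variables (sigma tau : gal_of {:L}) (a b : L).
Hypothesis dimL : \dim {:L} = m.
Hypothesis gen_sigma : generator 'Gal({:L} / 1%VS)%g sigma.
Hypothesis gen_tau : generator 'Gal({:L} / 1%VS)%g tau.
Hypothesis m_gt1 : (1 < m)%N.
Hypothesis a_notin : a \notin 1%VS.
Hypothesis b_notin : b \notin 1%VS.
Local Notation V := {ffun 'I_m -> L}.
Local Notation S := (shift sigma a).
Local Notation T := (shift tau b).

Variables (P Q H : V -> V).
Hypothesis PQH : forall x y,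
  H (petit_mul sigma a x y) = petit_mul tau b (P x) (Q y).
Hypothesis HD : forall x y, H (x + y) = H x + H y.
Hypothesis HF : forall (c : F) x, H (c%:A *v x) = c%:A *v H x.
Hypothesis H_inj : injective H.
Hypothesis H_surj : forall z, exists x, H x = z.
Hypothesis QD : forall x y, Q (x + y) = Q x + Q y.
Hypothesis QF : forall (c : F) x, Q (c%:A *v x) = c%:A *v Q x.
Hypothesis Q_surj : forall z, exists x, Q x = z.
Hypothesis P_surj : forall z, exists x, P x = z.

Variable i0 : 'I_m.
Hypothesis i00 : i0 = 0%N :> nat.

Lemma semilinear_H :
  exists rho : gal_of {:L}, forall l x, H (l *v x) = rho l *v H x.
Proof.
apply: (semilinear_gal i0 HD HF H_surj) => l.
apply: (left_nucleus dimL gen_tau m_gt1 b_notin i00 H_surj) => g.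
have [x <-] := P_surj g; exists (P (l *v x)) => y z.
have [y' <-] := Q_surj z; rewrite -PQH => /H_inj->.
by rewrite -petit_mulZl PQH.
Qed.

Lemma semilinear_Q :
  exists rho : gal_of {:L}, forall l x, Q (l *v x) = rho l *v Q x.
Proof.
apply: (semilinear_gal i0 QD QF Q_surj) => l.
apply: (middle_nucleus dimL gen_tau m_gt1 b_notin i00 Q_surj) => g.
have [x <-] := P_surj g.
exists (P [ffun i : 'I_m => x i * iter i sigma l]) => y.
rewrite -!PQH; congr (H _); rewrite !petit_mulE; apply: eq_bigr => i _.
by rewrite iter_shiftZ lscaleA ffunE.
Qed.

(** Both sides of [H (t^i * y) = P(t^i) * Q y] are semilinear in [y].  The left
    one is so for a single automorphism, whereas the coefficient of [t^k] in
    [P(t^i)] contributes the automorphism [tau^k] on the right: only one [k]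
    can occur. *)
Lemma P_monomial : exists2 rr : gal_of {:L} * gal_of {:L},
  (forall l x, H (l *v x) = rr.1 l *v H x) &
  forall i : 'I_m, exists l : 'I_m, exists c : L,
    [/\ c != 0, P (t_pow L i) = c *v t_pow L l
      & (rr.2 * tau ^+ l = sigma ^+ i * rr.1)%g].
Proof.
have [rho rhoP] := semilinear_H; have [rho' rhoP'] := semilinear_Q.
exists (rho, rho') => //= i; have [y0 Qy0] := Q_surj (t_pow L i0).
have Pi : H (iter i S y0) = P (t_pow L i).
  by rewrite -petit_mul_t_pow PQH Qy0 (petit_mulx1 tau b i00).
have comp (k : 'I_m) : P (t_pow L i) k != 0 ->
    (rho' * tau ^+ k = sigma ^+ i * rho)%g.
  move=> Pk; apply/eqP/gal_eqP => l _; rewrite !galM ?memvf //.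
  apply: (mulfI Pk).
  have : H (iter i S (l *v y0))
      = petit_mul tau b (P (t_pow L i)) (rho' l *v t_pow L i0).
    by rewrite -petit_mul_t_pow PQH rhoP' Qy0.
  rewrite iter_shiftZ rhoP Pi petit_mulE iter_gal => /ffunP/(_ k).
  rewrite sum_ffunE (bigD1 k) //= big1 => [|j njk].
    rewrite !ffunE addr0 iter_shiftZ (iter_shift_t_pow0 tau b k i00).
    by rewrite !ffunE eqxx mulr1 iter_gal mulrC => ->.
  rewrite !ffunE iter_shiftZ (iter_shift_t_pow0 tau b j i00).
  by rewrite !ffunE eq_sym (negPf njk) !mulr0.
have [|k Pk top] := @exists_top _ _ _ (P (t_pow L i)).
  apply: contra (t_pow_neq0 L i) => /eqP P0; apply/eqP/H_inj.
  rewrite -[in LHS](petit_mulx1 sigma a i00 (t_pow L i)) PQH P0 petit_mul0l.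
  by apply: (addIr (H 0)); rewrite -HD !add0r.
exists k, (P (t_pow L i) k); split=> //; last exact: comp.
apply/ffunP=> j; rewrite !ffunE; case: eqP => [->|njk]; first by rewrite mulr1.
rewrite mulr0; apply/eqP; apply: contra_notT njk => Pj; apply: val_inj => /=.
have /eqP := comp j Pj; rewrite -(comp k Pk) (inj_eq (mulgI _)).
rewrite eq_expg_mod_order (order_generator dimL gen_tau) !modn_small //.
by move/eqP.
Qed.

Lemma iter_shift_surj n (z : V) : exists y, iter n S y = z.
Proof.
have m_surj (x : V) : exists y, iter m S y = x.
  exists [ffun k : 'I_m => (iter k sigma a)^-1 * x k]; apply/ffunP=> k.
  rewrite (iter_m_shift a _ _ (expg_m dimL gen_sigma)) ffunE mulrA mulfV ?mul1r //.
  by apply/iter_gal_neq0/notin1_neq0.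
have mn_surj (x : V) : exists y, iter (m * n) S y = x.
  elim: n x => [|n IHn] x; first by rewrite muln0; exists x.
  have [y <-] := m_surj x; have [y' <-] := IHn y; exists y'.
  by rewrite mulnS iterD.
have [y <-] := mn_surj z; exists (iter (m * n - n) S y).
by rewrite -iterD subnKC // leq_pmull // ltnW.
Qed.

(** The second relation is [H S H^-1 = T^-1 d], written without the inverse
    of [T]. *)
Lemma shift_conjugate : exists2 rho : gal_of {:L},
  (forall l x, H (l *v x) = rho l *v H x) &
  exists2 d : L, d != 0 &
    (tau = sigma /\ forall x, H (S x) = d *v T (H x)) \/
    (tau = (sigma^-1)%g /\ forall x, T (H (S x)) = d *v H x).
Proof.
have [[rho rho'] /= Hsemi mono] := P_monomial; exists rho => //.
have [l_ /fin_all_exists[c_ mon]] := fin_all_exists mono.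
pose p n : nat := l_ (insubd i0 n); pose c n := c_ (insubd i0 n).
have c0 n : c n != 0 by case: (mon (insubd i0 n)).
have lt_p n : (p n < m)%N by apply: ltn_ord.
have Hp n y : (n < m)%N -> H (iter n S y) = c n *v iter (p n) T (Q y).
  move=> lt_n; have [_ Pn _] := mon (insubd i0 n).
  have e : insubd i0 n = n :> nat by rewrite val_insubd lt_n.
  by rewrite -{1}e -petit_mul_t_pow PQH Pn petit_mulZl petit_mul_t_pow.
have [u lt_u def_sigma] := gal_expg dimL gen_tau sigma.
have u_gt0 : (0 < u)%N.
  rewrite lt0n; apply: contraTneq m_gt1 => u0.
  by rewrite -(order_generator dimL gen_sigma) def_sigma u0 expg0 order1.
have cTT (k l : nat) : (tau ^+ k * tau ^+ l = tau ^+ l * tau ^+ k)%g.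
  by rewrite -!expgD addnC.
have p_mod n : (n.+1 < m)%N -> p n.+1 = p n + u %[mod m].
  move=> lt_n1; have lt_n := ltnW lt_n1.
  have [_ _] := mon (insubd i0 n.+1); rewrite -/(p n.+1) val_insubd lt_n1.
  have [_ _] := mon (insubd i0 n); rewrite -/(p n) val_insubd lt_n.
  have [j _ ->] := gal_expg dimL gen_tau rho => e1 e2.
  apply/eqP; have := eq_expg_mod_order tau (p n.+1) (p n + u).
  rewrite (order_generator dimL gen_tau) => <-.
  rewrite -(inj_eq (mulgI rho')) e2 expgD mulgA e1 expgS def_sigma -!expgM.
  by rewrite -!expgD; apply/eqP; congr (tau ^+ _)%g; rewrite -addnA addnC.
(* The exponents are less than m, so adding u modulo m either adds u or
   subtracts m - u. *)
have p_step n : (n.+1 < m)%N -> p n.+1 = (p n + u)%N \/ (p n.+1 + (m - u))%N = p n.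
  move=> lt_n1; have := p_mod n lt_n1; rewrite (modn_small (lt_p _)).
  have [lt_pu|le_pu] := ltnP (p n + u)%N m; first by rewrite modn_small //; left.
  have lt_pum : (p n + u - m < m)%N.
    by rewrite ltn_subLR // -addnS (leq_add (ltnW (lt_p n)) lt_u).
  rewrite -{1}(subnK le_pu) modnDr modn_small // => ->; right.
  by rewrite addnBA ?(ltnW lt_u) // subnK // addnK.
pose up := exists2 d : L, d != 0 & forall x, H (S x) = d *v iter u T (H x).
pose down :=
  exists2 d : L, d != 0 & forall x, iter (m - u) T (H (S x)) = d *v H x.
have upP n : (n.+1 < m)%N -> p n.+1 = (p n + u)%N -> up.
  move=> lt_n1 pn; exists (c n.+1 / iter u tau (c n)).
    by rewrite mulf_neq0 ?invr_eq0 ?iter_gal_neq0.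
  move=> x; have [y <-] := iter_shift_surj n x.
  rewrite -iterS Hp // pn Hp 1?ltnW // iter_shiftZ lscaleA divfK ?iter_gal_neq0 //.
  by rewrite addnC iterD.
have downP n : (n.+1 < m)%N -> (p n.+1 + (m - u))%N = p n -> down.
  move=> lt_n1 pn; exists (iter (m - u) tau (c n.+1) / c n).
    by rewrite mulf_neq0 ?invr_eq0 ?iter_gal_neq0.
  move=> x; have [y <-] := iter_shift_surj n x.
  rewrite -iterS Hp // Hp 1?ltnW // -pn iter_shiftZ lscaleA divfK //.
  by rewrite addnC iterD.
(* Together they would give T^(m-u) d T^u = d', so T^m would be a scalar. *)
have not_both : up -> down -> False.
  case=> d d0 upE [d' _ downE].
  have /eqP : iter (m - u) tau d = 0; last by apply/negP/iter_gal_neq0.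
  apply: (iter_m_shift_not_scalar dimL gen_tau m_gt1 b_notin i00 (d := d')) => z.
  have [x <-] := H_surj z; rewrite -downE upE iter_shiftZ -iterD.
  by rewrite subnK // ltnW.
have m1 : (0 < m.-1)%N by rewrite -ltnS prednK // ltnW.
have le_p n : (p n <= m.-1)%N by rewrite -ltnS prednK // ltnW.
have lt_m1 n : (n < m.-1)%N -> (n.+1 < m)%N.
  by rewrite -ltnS prednK // ltnW.
(* The step has the same sign all along, so p covers a distance of (m - 1) u,
   or (m - 1) (m - u), inside an interval of length m - 1. *)
have [p1|p1] := p_step 0%N m_gt1.
  have upT := upP _ m_gt1 p1.
  have pE n : (n <= m.-1)%N -> p n = (p 0%N + n * u)%N.
    elim: n => [|n IHn] lt_n; first by rewrite addn0.
    have [->|/(downP _ (lt_m1 n lt_n))] := p_step n (lt_m1 n lt_n).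
      by rewrite IHn 1?ltnW // mulSn addnCA addnC.
    by move/(not_both upT).
  have u1 : u = 1%N.
    apply/eqP; rewrite eqn_leq u_gt0 andbT -(leq_pmul2l m1) muln1.
    by apply: leq_trans (le_p m.-1); rewrite pE // leq_addl.
  have [d d0 dP] := upT; exists d => //; left; split.
    by rewrite def_sigma u1.
  by move: dP; rewrite u1.
have downT := downP _ m_gt1 p1.
have pE n : (n <= m.-1)%N -> (p n + n * (m - u))%N = p 0%N.
  elim: n => [|n IHn] lt_n; first by rewrite addn0.
  have [/(upP _ (lt_m1 n lt_n))/not_both/(_ downT) []|] := p_step n (lt_m1 n lt_n).
  by move=> e; rewrite mulSn addnA e IHn // ltnW.
have u1 : (m - u)%N = 1%N.
  apply/eqP; rewrite eqn_leq subn_gt0 lt_u andbT -(leq_pmul2l m1) muln1.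
  by apply: leq_trans (le_p 0%N); rewrite -(pE m.-1) // leq_addl.
have [d d0 dP] := downT; exists d => //; right; split.
  apply/eqP; rewrite eq_sym eq_invg_mul def_sigma -expgSr.
  by rewrite -addn1 -[X in (u + X)%N]u1 subnKC ?(ltnW lt_u) // (expg_m dimL gen_tau).
by move: dP; rewrite u1.
Qed.

(** Iterating the conjugation relation [m] times, from the vector 1 with
    [S^m 1 = a 1], gives [rho(a) = N(d) tau^k(b)] or [rho(a) tau^k(b) = N(d)],
    where [k] is the place of a nonzero coefficient of [H 1].  The power of
    [tau] is then moved to the left hand side. *)
Theorem isotopic_classification : isotopy_condition sigma a tau b.
Proof.
have [rho Hsemi [d d0 conj]] := shift_conjugate.
have /exists_top[k Hk _] : H (t_pow L i0) != 0.
  apply: contra (t_pow_neq0 L i0) => /eqP H0; apply/eqP/H_inj; rewrite H0.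
  by apply: (addIr (H 0)); rewrite -HD !add0r.
have [N defN] := vlineP _ _ (pnorm_in1 dimL gen_tau d).
have taum := expg_m dimL gen_tau.
have HSm : H (iter m S (t_pow L i0)) = rho a *v H (t_pow L i0).
  by rewrite iter_shift_m // Hsemi.
case: conj => [[def_tau upE]|[def_tau downE]]; [left|right]; split=> //.
  have upn n x : H (iter n S x) = pnorm tau n d *v iter n T (H x).
    elim: n => [|n IHn]; first by rewrite pnorm0 lscale1.
    by rewrite iterS upE IHn shiftZ lscaleA pnormS.
  exists (rho * (tau ^+ k)^-1)%g, N.
  have := upn m (t_pow L i0); rewrite HSm => /ffunP/(_ k).
  rewrite !ffunE iter_m_shift // mulrA => /(mulIf Hk) rho_a.
  rewrite galM ?memvf // rho_a defN mulr_algl linearZ /= iter_gal.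
  by rewrite -galM ?memvf // mulgV gal_id.
have downn n x : iter n T (H (iter n S x)) = pnorm tau n d *v H x.
  elim: n x => [|n IHn] x; first by rewrite pnorm0 lscale1.
  rewrite [iter _ S _]iterSr iterS IHn shiftZ downE lscaleA.
  by rewrite pnormS mulrC.
exists (rho * (tau ^+ k)^-1)%g, N.
have := downn m (t_pow L i0); rewrite HSm => /ffunP/(_ k).
rewrite iter_m_shift // !ffunE mulrA => /(mulIf Hk) rho_a.
have -> : b = ((tau ^+ k)^-1)%g (iter k tau b).
  by rewrite iter_gal -galM ?memvf // mulgV gal_id.
by rewrite galM ?memvf // -rmorphM /= mulrC rho_a defN linearZ /= rmorph1.
Qed.

End Isotopisms.

(** * Surjectivity of the norm, and isomorphisms *)

Section NormSurjective.

(** If [X^n - k] had no root, then all the nonzero elements, which are the roots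
    of [X^(n e) - 1 = (X^n - k) g], would be roots of [g], and the degree of [g]
    is too small for that. *)
Lemma finField_has_root (K : finFieldType) (n e : nat) (k : K) :
  #|K|.-1 = (n * e)%N -> k ^+ e = 1 -> exists x, x ^+ n = k.
Proof.
move=> cardK ke.
suff /existsP[x /eqP xn] : [exists x, x ^+ n == k] by exists x.
apply: contraT; rewrite negb_exists => /forallP no_root.
have ne_gt0 : (0 < n * e)%N.
  by rewrite -cardK -ltnS prednK ?finNzRing_gt1 // ltnW ?finNzRing_gt1.
have [n_gt0 e_gt0] : (0 < n)%N /\ (0 < e)%N by apply/andP; rewrite -muln_gt0.
pose p := 'X^n - k%:P : {poly K}.
pose g := \sum_(i < e) 'X^n ^+ (e.-1 - i) * k%:P ^+ i : {poly K}.
have pg : p * g = 'X^(n * e) - 1%:P.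
  by rewrite -subrXX -exprM -rmorphXn /= ke.
have sz_pg : size (p * g) = (n * e).+1 by rewrite pg size_XnsubC.
have pg0 : p * g != 0 by rewrite -size_poly_gt0 sz_pg.
move: (pg0); rewrite mulf_eq0 negb_or => /andP[p0 g0].
have sz_g : (size g <= n * e)%N.
  move: sz_pg; rewrite size_mul // size_XnsubC // addSn /= => sz.
  by rewrite -ltnS -sz -addn1 addnC leq_add2r.
have roots : all (root g) (enum (predC1 (0 : K))).
  apply/allP => x; rewrite mem_enum /= => x0.
  have : root (p * g) x.
    by rewrite pg rootE !hornerE -cardK -(inj_eq (mulfI x0)) mulr0 mulrBr -exprS
      prednK ?expf_card ?mulr1 ?subrr // (leq_trans _ (finNzRing_gt1 _)).
  rewrite rootM => /orP[|//]; rewrite rootE !hornerE subr_eq0 => xk.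
  by have := no_root x; rewrite xk.
have := max_poly_roots g0 roots (enum_uniq _).
rewrite -cardE cardC1 cardK => /leq_trans/(_ sz_g); by rewrite ltnn.
Qed.

Variables (F : finFieldType) (L : splittingFieldType F) (m : nat).
Hypothesis dimL : \dim {:L} = m.

Lemma galNorm_pnorm (sigma : gal_of {:L}) d :
  generator 'Gal({:L} / 1%VS)%g sigma ->
  galNorm 1%VS {:L} d = pnorm sigma m d.
Proof.
move=> gen_sigma; have inj : {in [set: 'I_m] &,
    injective (fun i : 'I_m => (sigma ^+ i)%g)}.
  move=> i j _ _ /eqP; rewrite eq_expg_mod_order (order_generator dimL gen_sigma).
  by rewrite !modn_small // => /eqP/val_inj.
rewrite /galNorm (eq_bigl (mem [set (sigma ^+ (i : 'I_m))%g | i in [set: 'I_m]])) => [|x].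
  rewrite big_imset //= /pnorm; apply: eq_big => [i|i _]; first by rewrite inE.
  by rewrite iter_gal.
rewrite mem_galT; have [i lt_i ->] := gal_expg dimL gen_sigma x.
by apply/esym/imsetP; exists (Ordinal lt_i).
Qed.

(** The norm is the power by [(q^m - 1) / (q - 1)], as is visible on the
    Frobenius generator, and it does not depend on the generator. *)
Lemma pnorm_surj (sigma : gal_of {:L}) (c : F) :
  generator 'Gal({:L} / 1%VS)%g sigma -> c != 0 ->
  exists2 d : L, d != 0 & pnorm sigma m d = c%:A.
Proof.
move=> gen_sigma c0.
have [alpha gen_alpha frob] := finField_galois_generator (sub1v {:L}).
have iter_frob i x : iter i alpha x = x ^+ (#|F| ^ i).
  elim: i => [|i IHi]; first by rewrite expr1.
  by rewrite iterS frob ?memvf // IHi -exprM /order dimv1 expn1 expnSr.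
have pnorm_alpha x : pnorm alpha m x = x ^+ (\sum_(i < m) #|F| ^ i).
  by rewrite expr_sum; apply: eq_bigr => i _; rewrite iter_frob.
have [||d dN] := @finField_has_root (finvect_type L)
  (\sum_(i < m) #|F| ^ i) (#|F|.-1) (c%:A : L).
- have -> : #|finvect_type L| = (#|F| ^ m)%N.
    by rewrite -(card_vspacef (Vector.on (finvect_type L))) card_vspace -dimL.
  rewrite predn_exp mulnC; congr (_ * _)%N.
- rewrite exprZn expr1n; suff -> : c ^+ #|F|.-1 = 1 by rewrite scale1r.
  by apply: (mulfI c0); rewrite -exprS prednK ?expf_card ?mulr1 //
    (leq_trans _ (finNzRing_gt1 _)).
have dc : pnorm sigma m d = c%:A.
  by rewrite -galNorm_pnorm // (galNorm_pnorm _ gen_alpha) pnorm_alpha.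
exists d => //; apply: contra_eq_neq dc => ->.
by rewrite -galNorm_pnorm // galNorm0 eq_sym scaler_eq0 oner_eq0 orbF.
Qed.

End NormSurjective.

Section Isomorphism.

Variables (F : finFieldType) (L : splittingFieldType F) (m : nat).
Variables (sigma rho : gal_of {:L}) (a b d : L).
Hypothesis dimL : \dim {:L} = m.
Hypothesis gen_sigma : generator 'Gal({:L} / 1%VS)%g sigma.
Hypothesis rho_a : rho a = pnorm sigma m d * b.
Hypothesis d0 : d != 0.
Local Notation V := {ffun 'I_m -> L}.

(** This sends [t] to [d t], and [(d t)^m] to [N(d) b = rho(a)]. *)
Definition petit_iso (x : V) : V := [ffun i : 'I_m => rho (x i) * pnorm sigma i d].

Lemma gal_comm x : rho (sigma x) = sigma (rho x).
Proof.
have [i _ ->] := gal_expg dimL gen_sigma rho.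
by rewrite -!iter_gal -iterSr.
Qed.

Lemma petit_isoD x y : petit_iso (x + y) = petit_iso x + petit_iso y.
Proof. by apply/ffunP=> i; rewrite !ffunE rmorphD mulrDl. Qed.

Lemma petit_isoZ l x : petit_iso (l *v x) = rho l *v petit_iso x.
Proof. by apply/ffunP=> i; rewrite !ffunE rmorphM mulrA. Qed.

Lemma petit_iso_t_pow i : petit_iso (t_pow L i) = pnorm sigma i d *v t_pow L i.
Proof.
apply/ffunP=> j; rewrite !ffunE; case: eqP => [->|_].
  by rewrite rmorph1 mulrC.
by rewrite rmorph0 mul0r mulr0.
Qed.

Lemma petit_iso_shift x :
  petit_iso (shift sigma a x) = d *v shift sigma b (petit_iso x).
Proof.
apply/ffunP=> k; rewrite !ffunE !rmorphM /= gal_comm.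
have m_gt0 : (0 < m)%N by apply: leq_ltn_trans (ltn_ord k).
case: eqP => k0.
  rewrite /= k0 add0n modn_small ?prednK // pnorm0 mulr1 rho_a.
  have := pnormS sigma m.-1 d; rewrite prednK // => ->.
  by rewrite -!mulrA; congr (_ * _); rewrite mulrCA; congr (_ * _); rewrite mulrC.
rewrite rmorph1 !mul1r mulrCA -pnormS /=.
have k_gt0 : (0 < k)%N by rewrite lt0n; apply/eqP.
by rewrite -subn1 -addnBAC // subn1 modnDr
  modn_small ?(leq_ltn_trans (leq_pred _)) // prednK.
Qed.

Lemma petit_iso_mul x y :
  petit_iso (petit_mul sigma a x y)
  = petit_mul sigma b (petit_iso x) (petit_iso y).
Proof.
have isoE n z : petit_iso (iter n (shift sigma a) z)
    = pnorm sigma n d *v iter n (shift sigma b) (petit_iso z).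
  elim: n => [|n IHn]; first by rewrite pnorm0 lscale1.
  by rewrite iterS petit_iso_shift IHn shiftZ lscaleA pnormS.
have iso0 : petit_iso 0 = 0.
  by apply: (addIr (petit_iso 0)); rewrite -petit_isoD !add0r.
rewrite !petit_mulE (big_morph _ petit_isoD iso0); apply: eq_bigr => i _.
by rewrite petit_isoZ isoE lscaleA ffunE.
Qed.

Lemma petit_iso_surj y : exists x, petit_iso x = y.
Proof.
exists [ffun i : 'I_m => (rho^-1)%g (y i / pnorm sigma i d)]; apply/ffunP=> i.
by rewrite !ffunE -galM ?memvf // mulVg gal_id divfK ?pnorm_neq0.
Qed.

Lemma petit_iso_inj : injective petit_iso.
Proof.
move=> x y /ffunP e; apply/ffunP=> i; have := e i; rewrite !ffunE.
by move/(mulIf (pnorm_neq0 sigma i d0))/fmorph_inj.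
Qed.

End Isomorphism.

(** * Codes and their equivalences *)

Section SpreadSets.

Lemma has_card_finType (T : finType) : has_card (fun _ : T => True) #|T|.
Proof.
exists (enum T); split; [exact: enum_uniq | by rewrite cardE |].
by move=> x; rewrite mem_enum.
Qed.

(** Distances in an additive family are ranks of its elements, here all equal to
    [n]; the Singleton-like bound is then the number [q ^ n] of row vectors. *)
Lemma spread_set_MRD (K : fieldType) (n : nat) (V : zmodType)
    (R : V -> 'M[K]_n) (C : code K n) (q : nat) (x1 : V) :
  (0 < n)%N -> (forall M, C M <-> exists x, M = R x) ->
  (forall x y, R (x - y) = R x - R y) ->
  (forall x, x != 0 -> row_free (R x)) -> x1 != 0 ->
  has_card (fun _ : K => True) q -> has_card (fun _ : V => True) (q ^ n) ->
  is_MRD C n.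
Proof.
move=> n_gt0 CE RB Rfree x1nz cardK [s [s_uniq s_size s_all]].
have R0 : R 0 = 0 by rewrite -(subrr 0) RB subrr.
have R_inj : injective R.
  move=> x y e; apply/eqP; rewrite -subr_eq0; apply: contraT => /Rfree.
  by rewrite RB e subrr /row_free mxrank0 eq_sym (negPf (lt0n_neq0 n_gt0)).
split; last first.
  exists q; rewrite // subnn add0n muln1; exists (map R s); split.
  - by rewrite map_inj_uniq.
  - by rewrite size_map.
  move=> M; split=> [/mapP[x _ ->]|/CE[x ->]]; first by apply/CE; exists x.
  by apply: map_f; apply/s_all.
split=> [M N /CE[x ->] /CE[y ->]|].
  rewrite (inj_eq R_inj) -subr_eq0 => /Rfree /eqP.
  by rewrite RB => ->.
exists (R x1), (R 0); split; [| | by rewrite (inj_eq R_inj)|].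
- by apply/CE; exists x1.
- by apply/CE; exists 0.
by rewrite -RB subr0; apply/eqP/Rfree.
Qed.

Lemma ker0_row_free (K : fieldType) (n : nat) (A : 'M[K]_n) :
  (forall v : 'rV_n, v *m A = 0 -> v = 0) -> row_free A.
Proof.
move=> ker0; rewrite -kermx_eq0; apply/rowV0P => v /sub_kermxP; exact: ker0.
Qed.

Lemma eq_mulmx_row (K : fieldType) (n p : nat) (A B : 'M[K]_(n, p)) :
  (forall v : 'rV_n, v *m A = v *m B) -> A = B.
Proof. by move=> e; apply/row_matrixP => i; rewrite !rowE e. Qed.

End SpreadSets.

Section Coordinates.

Variables (F : fieldType) (V : vectType F) (n : nat).

Definition coord_row (e : n.-tuple V) (x : V) : 'rV[F]_n := \row_i coord e i x.

Definition row_vect (e : n.-tuple V) (v : 'rV[F]_n) : V :=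
  \sum_i v 0 i *: tnth e i.

Definition matrix_of (e : n.-tuple V) (g : V -> V) : 'M[F]_n :=
  \matrix_(i, j) coord e j (g (tnth e i)).

Lemma row_vect_linear e : linear (row_vect e).
Proof.
move=> c u v; rewrite scaler_sumr -big_split; apply: eq_bigr => i _ /=.
by rewrite !mxE scalerDl scalerA.
Qed.

Lemma coord_row_linear e : linear (coord_row e).
Proof. by move=> c x y; apply/rowP=> i; rewrite !mxE linearP. Qed.

Variable e : n.-tuple V.
Hypothesis basis_e : basis_of fullv e.

Lemma coord_rowK : cancel (coord_row e) (row_vect e).
Proof.
move=> x; rewrite [RHS](coord_basis basis_e (memvf x)).
by apply: eq_bigr => i _; rewrite !mxE (tnth_nth 0).
Qed.

Lemma row_vectK : cancel (row_vect e) (coord_row e).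
Proof.
move=> v; apply/rowP=> i; rewrite !mxE /row_vect.
rewrite (eq_bigr (fun i => v 0 i *: e`_i)) => [|j _]; last by rewrite (tnth_nth 0).
by rewrite coord_sum_free ?(basis_free basis_e).
Qed.

Lemma coord_row_mul g x : linear g ->
  coord_row e x *m matrix_of e g = coord_row e (g x).
Proof.
move=> g_lin; pose gL : {linear V -> V} :=
  HB.pack g (GRing.isLinear.Build F V V _ g g_lin).
have gE : g (row_vect e (coord_row e x)) = \sum_i coord e i x *: g (tnth e i).
  apply: etrans (linear_sum gL _ _ _) _; apply: eq_bigr => i _.
  by rewrite mxE; apply: (linearZZ gL).
apply/rowP=> j; rewrite !mxE -[x in RHS]coord_rowK gE linear_sum.
by apply: eq_bigr => i _; rewrite !mxE linearZ.
Qed.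

Lemma matrix_of_unit g g' : linear g -> linear g' -> cancel g g' ->
  matrix_of e g \in unitmx.
Proof.
move=> g_lin g'_lin gK.
suff /mulmx1_unit[] : matrix_of e g *m matrix_of e g' = 1%:M by [].
apply: eq_mulmx_row => v; rewrite -(row_vectK v) mulmxA !coord_row_mul // gK.
by rewrite mulmx1.
Qed.

End Coordinates.

Section Codes.

Variables (F : finFieldType) (L : splittingFieldType F) (m : nat).
Hypothesis dimL : \dim {:L} = m.
Hypothesis m_gt1 : (1 < m)%N.
Local Notation V := {ffun 'I_m -> L}.
Implicit Types (sigma tau : gal_of {:L}) (a b : L).

Let m_gt0 : (0 < m)%N := ltnW m_gt1.
Let i0 : 'I_m := Ordinal m_gt0.
Let i00 : i0 = 0%N :> nat := erefl.

Lemma petit_mulr_linear sigma a (x : petit_space L m) :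
  linear (fun y : petit_space L m => petit_mul sigma a y x : petit_space L m).
Proof. by move=> c y z; rewrite !petit_scaleE petit_mulDl petit_mulZl. Qed.

Lemma right_mul_mxFE sigma a (e : (m ^ 2).-tuple (petit_space L m)) :
  basis_of fullv e -> forall (x y : petit_space L m),
  coord_row e y *m right_mul_mxF sigma a e x
  = coord_row e (petit_mul sigma a y x : petit_space L m).
Proof. by move=> be x y; apply: (coord_row_mul be _ (petit_mulr_linear sigma a x)). Qed.

Lemma card_vect : has_card (fun _ : L => True) (#|F| ^ m).
Proof.
have := has_card_finType (finvect_type L); congr has_card.
by rewrite -(card_vspacef (Vector.on (finvect_type L))) card_vspace -dimL.
Qed.

Lemma card_petit_space : has_card (fun _ : V => True) ((#|F| ^ m) ^ m).
Proof.
have := has_card_finType {ffun 'I_m -> finvect_type L}; congr has_card.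
rewrite card_ffun card_ord; congr (_ ^ _)%N.
by rewrite -(card_vspacef (Vector.on (finvect_type L))) card_vspace -dimL.
Qed.

Lemma petit_mulBr sigma a (g x y : V) :
  petit_mul sigma a g (x - y) = petit_mul sigma a g x - petit_mul sigma a g y.
Proof. by apply/esym/eqP; rewrite subr_eq -petit_mulDr subrK. Qed.

Lemma corresponds_F_good sigma a C : prime m ->
  generator 'Gal({:L} / 1%VS)%g sigma -> a \notin 1%VS ->
  corresponds_F sigma a C -> @linear_MRD_F F m C.
Proof.
move=> pr_m gen_sigma na [e basis_e CE].
pose R x := right_mul_mxF sigma a e x.
have RD c x y : R (c *: x + y) = c *: R x + R y.
  apply/matrixP=> i j; rewrite !mxE -linearP; congr (coord _ _ _).
  by rewrite !petit_scaleE petit_mulDr petit_scaler.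
have RB x y : R (x - y) = R x - R y.
  by have := RD (-1) y x; rewrite !scaleN1r [- y + x]addrC [- R y + _]addrC.
have R0 : R 0 = 0 by rewrite -(subrr 0) RB subrr.
split; first split.
- by apply/CE; exists 0.
- by move=> c M N /CE[x ->] /CE[y ->]; apply/CE; exists (c *: x + y); apply/esym/RD.
apply: (@spread_set_MRD F _ (petit_space L m) R C #|F| (t_pow L i0)) => //.
- by rewrite expn_gt0 m_gt0.
- move=> x x0; apply: ker0_row_free => v.
  rewrite -(row_vectK basis_e v).
  rewrite right_mul_mxFE //.
  move/(congr1 (row_vect e)); rewrite !coord_rowK //.
  rewrite [row_vect e 0]big1 => [|i _]; last by rewrite mxE scale0r.
  case/(petit_division dimL gen_sigma pr_m na) => [->|/eqP]; last first.
    by rewrite (negPf x0).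
  by apply/rowP=> i; rewrite !mxE linear0.
- exact: t_pow_neq0.
- exact: has_card_finType.
by have := card_petit_space; rewrite -expnM mulnn.
Qed.

Lemma right_mul_mxLE sigma a (x : V) (v : 'rV[L]_m) :
  v *m right_mul_mxL sigma a x
  = \row_j petit_mul sigma a [ffun i => v 0 i] x j.
Proof.
apply/rowP=> j; rewrite !mxE [in RHS](sum_t_pow [ffun i => v 0 i]).
rewrite petit_mul_suml sum_ffunE; apply: eq_bigr => i _.
by rewrite petit_mulZl !mxE !ffunE.
Qed.

Lemma corresponds_L_good sigma a C : prime m ->
  generator 'Gal({:L} / 1%VS)%g sigma -> a \notin 1%VS ->
  corresponds_L sigma a C -> @linear_MRD_L F L m C.
Proof.
move=> pr_m gen_sigma na CE.
pose R (x : V) := right_mul_mxL sigma a x.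
have RD c (x y : V) : R (c%:A *v x + y) = c%:A *: R x + R y.
  apply/matrixP=> i j; rewrite !mxE petit_mulDr petit_scaler.
  by rewrite !ffunE.
have RB x y : R (x - y) = R x - R y.
  by apply/matrixP=> i j; rewrite !mxE petit_mulBr !ffunE.
have R0 : R 0 = 0 by rewrite -(subrr 0) RB subrr.
split; first split.
- by apply/CE; exists 0.
- by move=> c M N /CE[x ->] /CE[y ->]; apply/CE; exists (c%:A *v x + y); apply/esym/RD.
apply: (@spread_set_MRD L _ V R C (#|F| ^ m) (t_pow L i0)) => //.
- move=> x x0; apply: ker0_row_free => v; rewrite right_mul_mxLE => /rowP v0.
  have : petit_mul sigma a [ffun i => v 0 i] x = 0.
    by apply/ffunP=> j; have := v0 j; rewrite !mxE => ->; rewrite [RHS]ffunE.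
  case/(petit_division dimL gen_sigma pr_m na) => [/ffunP w0|/eqP]; last first.
    by rewrite (negPf x0).
  by apply/rowP=> i; have := w0 i; rewrite !ffunE mxE.
- exact: t_pow_neq0.
- exact: card_vect.
exact: card_petit_space.
Qed.

Section Equivalent.

Variables (sigma tau : gal_of {:L}) (a b : L).
Hypothesis gen_sigma : generator 'Gal({:L} / 1%VS)%g sigma.
Hypothesis gen_tau : generator 'Gal({:L} / 1%VS)%g tau.
Hypothesis a_notin : a \notin 1%VS.
Hypothesis b_notin : b \notin 1%VS.

(** Writing [x'] as [Q x] and substituting the inverse [P] of [p] turns the
    equality of the two sets of right multiplications, up to composition with
    [u] and [p], into an isotopism. *)
Lemma isotopic_spread_sets (p u u' : petit_space L m -> petit_space L m) :
  linear u ->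
  cancel u u' -> cancel u' u -> bijective p ->
  (forall x, exists x', forall y,
     u (petit_mul sigma a (p y) x) = petit_mul tau b y x') ->
  (forall x', exists x, forall y,
     u (petit_mul sigma a (p y) x) = petit_mul tau b y x') ->
  isotopy_condition sigma a tau b.
Proof.
move=> u_lin uK u'K [P pK PK] CD DC.
pose uL : {linear petit_space L m -> petit_space L m} :=
  HB.pack u (GRing.isLinear.Build F _ _ _ u u_lin).
have uD (x y : V) : u (x + y) = u x + u y by apply: (raddfD uL).
have uF (c : F) (x : V) : u (c%:A *v x) = c%:A *v u x.
  by rewrite -!petit_scaleE; apply: (linearZZ uL).
pose Q x := u (petit_mul sigma a (p (t_pow L i0)) x).
have QE x x' : (forall y, u (petit_mul sigma a (p y) x) = petit_mul tau b y x') ->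
    x' = Q x.
  by move=> e; rewrite /Q e petit_mul_t_pow.
apply: (@isotopic_classification F L m sigma tau a b dimL gen_sigma gen_tau
  m_gt1 a_notin b_notin P Q u _ uD uF (can_inj uK) _ _ _ _ _ i0 i00).
- move=> x y; have [x' e] := CD y.
  by rewrite -{1}(PK x) e (QE _ _ e).
- by move=> z; exists (u' z).
- by move=> x y; rewrite /Q petit_mulDr uD.
- by move=> c x; rewrite /Q petit_scaler uF.
- by move=> z; have [x /QE ->] := DC z; exists x.
by move=> z; exists (p z).
Qed.

(** The two codes may be written in different bases, so [X] and [Y] are read as
    maps that change the basis as well. *)
Lemma equiv_F_classes C D : corresponds_F sigma a C -> corresponds_F tau b D ->
  @equiv_F F (m ^ 2) C D -> isotopy_condition sigma a tau b.
Proof.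
case=> e be CE [e' be' DE] [X [Y [uX uY XY]]].
pose p y := row_vect e (coord_row e' y *m X).
pose u z := row_vect e' (coord_row e z *m Y).
pose p' y := row_vect e' (coord_row e y *m invmx X).
pose u' z := row_vect e (coord_row e' z *m invmx Y).
have upE x x' : right_mul_mxF tau b e' x' = X *m right_mul_mxF sigma a e x *m Y ->
    forall y, u (petit_mul sigma a (p y) x) = petit_mul tau b y x'.
  move=> eXY y; apply: (can_inj (coord_rowK be')).
  rewrite -(right_mul_mxFE _ _ be') eXY /u row_vectK // -(right_mul_mxFE _ _ be).
  by rewrite /p row_vectK // !mulmxA.
apply: (@isotopic_spread_sets p u u').
- by move=> c x y; rewrite /u coord_row_linear mulmxDl -scalemxAl row_vect_linear.
- by move=> z; rewrite /u' /u row_vectK // mulmxK // coord_rowK.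
- by move=> z; rewrite /u' /u row_vectK // mulmxKV // coord_rowK.
- by exists p' => z; rewrite /p /p' row_vectK // ?mulmxK ?mulmxKV // coord_rowK.
- move=> x; have /XY/DE[x' ex'] : exists2 M, C M &
      X *m right_mul_mxF sigma a e x *m Y = X *m map_mx id M *m Y.
    by exists (right_mul_mxF sigma a e x); [apply/CE; exists x | rewrite map_mx_id].
  by exists x'; apply: upE.
move=> x'; have /XY[M /CE[x ->]] : D (right_mul_mxF tau b e' x').
  by apply/DE; exists x'.
by rewrite map_mx_id // => ex; exists x; apply: upE.
Qed.

Lemma equiv_L_classes C D : corresponds_L sigma a C -> corresponds_L tau b D ->
  @equiv_L F L m C D -> isotopy_condition sigma a tau b.
Proof.
move=> CE DE [X [Y [rho [uX uY _ XY]]]].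
pose row_of (y : V) : 'rV[L]_m := \row_i y i.
pose fun_of (v : 'rV[L]_m) : V := [ffun i => v 0 i].
have row_ofK : cancel row_of fun_of by move=> y; apply/ffunP=> i; rewrite ffunE mxE.
have fun_ofK : cancel fun_of row_of by move=> v; apply/rowP=> i; rewrite mxE ffunE.
pose p y := fun_of (map_mx (rho^-1)%g (row_of y *m X)).
pose p' y := fun_of (map_mx rho (row_of y) *m invmx X).
pose u z := fun_of (map_mx rho (row_of z) *m Y).
pose u' z := fun_of (map_mx (rho^-1)%g (row_of z *m invmx Y)).
have rhoK n (v : 'rV[L]_n) : map_mx rho (map_mx (rho^-1)%g v) = v.
  by apply/rowP=> i; rewrite !mxE -galM ?memvf // mulVg gal_id.
have rhoVK n (v : 'rV[L]_n) : map_mx (rho^-1)%g (map_mx rho v) = v.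
  by apply/rowP=> i; rewrite !mxE -galM ?memvf // mulgV gal_id.
have rowE s c x y : row_of y *m right_mul_mxL s c x = row_of (petit_mul s c y x).
  rewrite right_mul_mxLE; apply/rowP=> j; rewrite !mxE.
  by rewrite -/(fun_of _) row_ofK.
have upE x x' : right_mul_mxL tau b x' = X *m map_mx rho (right_mul_mxL sigma a x) *m Y ->
    forall y, u (petit_mul sigma a (p y) x) = petit_mul tau b y x'.
  move=> eXY y; apply: (can_inj row_ofK).
  by rewrite -rowE eXY /u fun_ofK -rowE map_mxM /p fun_ofK rhoK !mulmxA.
apply: (@isotopic_spread_sets p u u').
- move=> c x y; apply: (can_inj row_ofK); rewrite fun_ofK.
  have -> : row_of (c *: (x : petit_space L m) + y) = c%:A *: row_of x + row_of y.
    by apply/rowP=> j; rewrite !mxE !ffunE mulr_algl.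
  have -> : map_mx rho (c%:A *: row_of x + row_of y)
      = c%:A *: map_mx rho (row_of x) + map_mx rho (row_of y).
    by apply/rowP=> j; rewrite !mxE rmorphD rmorphM /= gal_alg.
  rewrite mulmxDl -scalemxAl; apply/rowP=> j.
  by rewrite [RHS]mxE !ffunE !mxE mulr_algl.
- by move=> z; rewrite /u' /u fun_ofK mulmxK // rhoVK row_ofK.
- by move=> z; rewrite /u' /u fun_ofK rhoK mulmxKV // row_ofK.
- exists p' => z; rewrite /p /p' fun_ofK.
    by rewrite rhoK mulmxK // row_ofK.
  by rewrite mulmxKV // rhoVK row_ofK.
- move=> x.
  have /XY/DE[x' ex'] : exists2 M, C M &
      X *m map_mx rho (right_mul_mxL sigma a x) *m Y = X *m map_mx rho M *m Y.
    by exists (right_mul_mxL sigma a x) => //; apply/CE; exists x.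
  by exists x'; apply: upE.
move=> x'; have /XY[M /CE[x ->]] : D (right_mul_mxL tau b x').
  by apply/DE; exists x'.
by move=> ex; exists x; apply: upE.
Qed.

End Equivalent.

Section Isomorphic.

Variables (sigma rho : gal_of {:L}) (a b d : L).
Hypothesis gen_sigma : generator 'Gal({:L} / 1%VS)%g sigma.
Hypothesis rho_a : rho a = pnorm sigma m d * b.
Hypothesis d0 : d != 0.
Local Notation iso := (@petit_iso F L m sigma rho d).

Lemma petit_iso_equiv_F C : corresponds_F sigma a C ->
  exists2 D, corresponds_F sigma b D & @equiv_F F (m ^ 2) C D.
Proof.
case=> e be CE.
exists (fun M => exists x, M = right_mul_mxF sigma b e x); first by exists e.
have iso_lin : linear (iso : petit_space L m -> petit_space L m).
  by move=> c x y; rewrite !petit_scaleE petit_isoD petit_isoZ gal_alg.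
pose isoL := linfun (HB.pack (iso : petit_space L m -> petit_space L m)
  (GRing.isLinear.Build F _ _ _ _ iso_lin) : {linear petit_space L m -> petit_space L m}).
have isoLE x : isoL x = iso x by rewrite lfunE.
have ker0 : lker isoL == 0%VS.
  by apply/lker0P => x y; rewrite !isoLE => /(petit_iso_inj d0).
pose iso' := (isoL^-1)%VF.
have isoK : cancel iso iso' by move=> x; rewrite -isoLE (lker0_lfunK ker0).
have iso'K : cancel iso' iso by move=> x; rewrite -isoLE (lker0_lfunVK ker0).
have iso'_lin : linear iso' by move=> c x y; rewrite linearP.
exists (matrix_of e iso'), (matrix_of e iso).
have key x : right_mul_mxF sigma b e (iso x)
    = matrix_of e iso' *m right_mul_mxF sigma a e x *m matrix_of e iso.
  apply: eq_mulmx_row => v; rewrite -(row_vectK be v) right_mul_mxFE // !mulmxA.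
  rewrite coord_row_mul // right_mul_mxFE // coord_row_mul //.
  rewrite (petit_iso_mul dimL gen_sigma rho_a).
  by congr (coord_row e (petit_mul _ _ _ _)); apply/esym/iso'K.
split; [exact: matrix_of_unit iso'K | exact: matrix_of_unit isoK |].
move=> N; split=> [[x ->]|[M /CE[x ->] ->]].
  exists (right_mul_mxF sigma a e (iso' x)); first by apply/CE; exists (iso' x).
  by rewrite map_mx_id // -key iso'K.
by exists (iso x); rewrite map_mx_id // key.
Qed.

(** On the basis of powers of [t] the isomorphism is [rho] followed by a diagonal
    matrix, so the codes differ by [rho] and conjugation by that matrix. *)
Lemma petit_iso_equiv_L C : corresponds_L sigma a C ->
  exists2 D, corresponds_L sigma b D & @equiv_L F L m C D.
Proof.
move=> CE; exists (fun M => exists x, M = right_mul_mxL sigma b x) => //.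
pose n i := pnorm sigma i d; have n0 i : n i != 0 by apply: pnorm_neq0.
pose X : 'M[L]_m := diag_mx (\row_i (n i)^-1).
pose Y : 'M[L]_m := diag_mx (\row_i n i).
exists X, Y, rho.
have key x : right_mul_mxL sigma b (iso x)
    = X *m map_mx rho (right_mul_mxL sigma a x) *m Y.
  apply/matrixP=> i j; rewrite mul_mx_diag mul_diag_mx !mxE.
  have tE : t_pow L i = (n i)^-1 *v iso (t_pow L i).
    by rewrite petit_iso_t_pow lscaleA mulVf ?lscale1.
  rewrite [in LHS]tE petit_mulZl -(petit_iso_mul dimL gen_sigma rho_a) -mulrA.
  by rewrite ffunE [X in _ * X]ffunE.
split.
- by rewrite unitmxE det_diag unitfE; apply/prodf_neq0 => i _; rewrite mxE invr_eq0.
- by rewrite unitmxE det_diag unitfE; apply/prodf_neq0 => i _; rewrite mxE.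
- exact: mem_galT.
move=> N; split=> [[y ->]|[M /CE[x ->] ->]]; last by exists (iso x).
have [x <-] := petit_iso_surj sigma rho d0 y.
by exists (right_mul_mxL sigma a x); [apply/CE; exists x|].
Qed.

End Isomorphic.
End Codes.

(** * Orbits, and representatives in the quadratic case *)

Section Orbits.

Variables (F : finFieldType) (L : splittingFieldType F) (m : nat).
Hypothesis dimL : \dim {:L} = m.

Definition same_orbit (a b : L) : Prop :=
  exists rho : gal_of {:L}, exists c : F, rho a = c *: b.

Definition orbit_reps (S : L -> Prop) : Prop :=
  (forall a, S a -> a \notin 1%VS) /\
  (forall a, a \notin 1%VS -> exists! b, S b /\ same_orbit a b).

Lemma represents_classes_of_orbits (K : fieldType) (n : nat)
    (good : code K n -> Prop) (equiv : code K n -> code K n -> Prop)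
    (corresponds : L -> code K n -> Prop) (S : L -> Prop) :
  (forall a C, a \notin 1%VS -> corresponds a C -> good C) ->
  (forall a b C D, a \notin 1%VS -> b \notin 1%VS ->
     corresponds a C -> corresponds b D -> equiv C D -> same_orbit a b) ->
  (forall a b C, a \notin 1%VS -> same_orbit a b -> corresponds a C ->
     exists2 D, corresponds b D & equiv C D) ->
  orbit_reps S -> represents_classes good equiv corresponds S.
Proof.
move=> corr_good equiv_orbit orbit_equiv [S_notin S_reps].
split=> [a Sa|C _ [a na aC]].
  by have na := S_notin a Sa; split=> // C; apply: corr_good.
have [b [[Sb ab] b_uniq]] := S_reps a na; exists b; split.
  by split=> //; apply: orbit_equiv na ab aC.
move=> b' [Sb' [D b'D CD]]; apply: b_uniq; split=> //.
exact: equiv_orbit na (S_notin _ Sb') aC b'D CD.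
Qed.

Variable sigma : gal_of {:L}.
Hypothesis gen_sigma : generator 'Gal({:L} / 1%VS)%g sigma.
Hypothesis prime_m : prime m.

Let m_gt1 : (1 < m)%N := prime_gt1 prime_m.

(** If [sigma] is its own inverse then [m = 2], and [b * sigma(b)] is in F, so
    that [rho(a) b] in F means that [rho(a)] is a multiple of [sigma(b)]. *)
Lemma isotopy_same_orbit (a b : L) : a \notin 1%VS -> b \notin 1%VS ->
  isotopy_condition sigma a sigma b -> same_orbit a b.
Proof.
move=> na nb [[_ //]|[inv [rho [c rho_ab]]]].
have sigma2 : (sigma ^+ 2 = 1)%g by rewrite expgS expg1 {1}inv mulVg.
have m2 : m = 2%N.
  apply/eqP; rewrite eqn_leq m_gt1 andbT dvdn_leq //.
  by rewrite -(order_generator dimL gen_sigma) order_dvdn sigma2.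
have [N defN] := vlineP _ _ (pnorm_in1 dimL gen_sigma b).
have {}defN : b * sigma b = N%:A.
  by rewrite -defN [in RHS]m2 /pnorm !big_ord_recl big_ord0 mulr1.
have b0 := notin1_neq0 nb.
have N0 : N != 0.
  apply: contraTneq b0 => N0; have /eqP := defN.
  by rewrite N0 scale0r mulf_eq0 fmorph_eq0 orbb negbK.
exists (rho * sigma)%g, (c / N).
rewrite galM ?memvf //; have -> : rho a = (c / N) *: sigma b.
  apply: (mulIf b0); rewrite rho_ab -scalerAl [_ * b]mulrC defN scalerA.
  by rewrite divfK.
by rewrite linearZ /= -galM ?memvf // -expg2 sigma2 gal_id.
Qed.

Lemma same_orbit_iso (a b : L) : a \notin 1%VS -> same_orbit a b ->
  exists2 d : L, d != 0 & exists rho : gal_of {:L}, rho a = pnorm sigma m d * b.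
Proof.
move=> na [rho [c rho_a]]; have c0 : c != 0.
  apply: contraTneq (notin1_neq0 na) => c0; move/eqP: rho_a.
  by rewrite c0 scale0r fmorph_eq0 negbK.
have [d d0 dN] := pnorm_surj dimL gen_sigma c0.
by exists d => //; exists rho; rewrite dN mulr_algl.
Qed.

Theorem represents_classes_FL (S : L -> Prop) : orbit_reps S ->
  represents_classes (@linear_MRD_F F m) (@equiv_F F (m ^ 2))
    (@corresponds_F F L m sigma) S /\
  represents_classes (@linear_MRD_L F L m) (@equiv_L F L m)
    (@corresponds_L F L m sigma) S.
Proof.
move=> S_reps; split; apply: represents_classes_of_orbits => //.
- by move=> a C na; apply: corresponds_F_good.
- move=> a b C D na nb aC bD CD; apply: isotopy_same_orbit => //.
  exact: equiv_F_classes aC bD CD.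
- move=> a b C na /(same_orbit_iso na)[d d0 [rho rho_a]].
  exact: petit_iso_equiv_F rho_a d0 C.
- by move=> a C na; apply: corresponds_L_good.
- move=> a b C D na nb aC bD CD; apply: isotopy_same_orbit => //.
  exact: equiv_L_classes aC bD CD.
move=> a b C na /(same_orbit_iso na)[d d0 [rho rho_a]].
exact: petit_iso_equiv_L rho_a d0 C.
Qed.

Theorem separates_generators_FL (S : L -> Prop) : orbit_reps S ->
  separates_generators (@equiv_F F (m ^ 2)) (@corresponds_F F L m) S /\
  separates_generators (@equiv_L F L m) (@corresponds_L F L m) S.
Proof.
case=> S_notin _; split=> s t a b C D gs gt /S_notin na /S_notin nb aC bD CD.
  by case: (equiv_F_classes dimL m_gt1 gs gt na nb aC bD CD)
    => [[-> _]|[-> _]]; [left|right].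
by case: (equiv_L_classes dimL m_gt1 gs gt na nb aC bD CD)
    => [[-> _]|[-> _]]; [left|right].
Qed.

End Orbits.

Section QuadraticRepresentatives.

Variables (F : finFieldType) (L : splittingFieldType F).
Variables (c : F) (r : L) (sigma : gal_of {:L}) (T : {set F}).
Hypothesis nonsquare : forall y : F, y ^+ 2 != c.
Hypothesis r2 : r ^+ 2 = c%:A.
Hypothesis dimL : \dim {:L} = 2%N.
Hypothesis gen_sigma : generator 'Gal({:L} / 1%VS)%g sigma.
Hypothesis T_reps : pm1_reps T.

Lemma r_notin : r \notin 1%VS.
Proof.
apply/negP => /vlineP[y ry]; have /eqP := r2; rewrite ry exprZn expr1n.
by rewrite -subr_eq0 -scalerBl scaler_eq0 oner_eq0 orbF subr_eq0 (negPf (nonsquare y)).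
Qed.

Lemma quadratic_coords x : exists p q : F, x = p%:A + q *: r.
Proof.
have free_r : free [:: r; 1].
  by rewrite !free_cons nil_free andbT span_seq1 r_notin span_nil memv0 oner_neq0.
have /span_basis full : basis_of {:L} [:: r; 1].
  by rewrite basisEfree free_r subvf dimL.
have := memvf x; rewrite -full span_cons span_seq1.
case/memv_addP=> _ /vlineP[q ->] [_ /vlineP[p ->] ->].
by exists p, q; rewrite addrC.
Qed.

Lemma quadratic_coords_uniq (p q p' q' : F) :
  p%:A + q *: r = p'%:A + q' *: r -> p = p' /\ q = q'.
Proof.
move=> e; have e' : (q - q') *: r = (p' - p)%:A.
  by apply/eqP; rewrite !scalerBl subr_eq addrAC -e addrAC subrr add0r.
have qq : q = q'.
  apply/eqP; rewrite -subr_eq0; apply: contraNT r_notin => nz.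
  rewrite -[r]scale1r -(mulVf nz) -scalerA e'.
  by rewrite scalerA; apply/vlineP; exists ((q - q')^-1 * (p' - p)).
split=> //; move/eqP: e'; rewrite qq subrr scale0r eq_sym scaler_eq0 oner_eq0 orbF.
by rewrite subr_eq0 eq_sym => /eqP.
Qed.

Lemma quadratic_gal (rho : gal_of {:L}) :
  exists2 d : F, d = 1 \/ d = -1 & rho r = d *: r.
Proof.
have : rho r ^+ 2 == r ^+ 2 by rewrite -rmorphXn /= r2 gal_alg.
rewrite eqf_sqr => /orP[/eqP->|/eqP->].
  by exists 1; [left | rewrite scale1r].
by exists (-1); [right | rewrite scaleN1r].
Qed.

Lemma sigma_r : sigma r = - r.
Proof.
have [d [->|->] e] := quadratic_gal sigma; last by rewrite e scaleN1r.
by have := gal_neq gen_sigma r_notin; rewrite e scale1r eqxx.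
Qed.

Lemma quadratic_notin (p q : F) : q != 0 -> p%:A + q *: r \notin 1%VS.
Proof.
move=> q0; apply/negP => /vlineP[y e]; case/negP: q0; apply/eqP.
have := @quadratic_coords_uniq p q y 0; rewrite scale0r addr0.
by case.
Qed.

Lemma quadratic_sigma (p q d : F) : d = 1 \/ d = -1 ->
  exists rho : gal_of {:L}, rho (p%:A + q *: r) = p%:A + (d * q) *: r.
Proof.
case=> ->; [exists 1%g | exists sigma].
  by rewrite gal_id mul1r.
by rewrite rmorphD /= gal_alg linearZ /= sigma_r mulN1r scaleNr scalerN.
Qed.

Lemma quadratic_gal_coords (rho : gal_of {:L}) (p q : F) :
  exists2 d : F, d = 1 \/ d = -1 & rho (p%:A + q *: r) = p%:A + (d * q) *: r.
Proof.
have [d d1 rho_r] := quadratic_gal rho; exists d => //.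
by rewrite rmorphD /= gal_alg linearZ /= rho_r scalerA mulrC.
Qed.

Lemma pm1_sqr (d : F) : d = 1 \/ d = -1 -> d * d = 1.
Proof. by case=> ->; rewrite ?mulr1 ?mulrNN ?mulr1. Qed.

Lemma pm1_in (d : F) : d \in [set 1; -1] <-> d = 1 \/ d = -1.
Proof.
by rewrite !inE; split=> [/orP[/eqP->|/eqP->]|[->|->]]; rewrite ?eqxx ?orbT; auto.
Qed.

Lemma pm1_reps_unique (y : F) : y != 0 -> exists t : F, [/\ t \in T, t != 0,
  exists2 d : F, d = 1 \/ d = -1 & y = t * d &
  forall t' d : F, t' \in T -> d = 1 \/ d = -1 -> y = t' * d -> t' = t].
Proof.
have [/subsetP T_sub reps] := T_reps => y0.
have [|t [[Tt [d /pm1_in d1 yE]] t_uniq]] := reps y; first by rewrite inE.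
exists t; split=> //; first by have := T_sub t Tt; rewrite inE.
  by exists d.
move=> t' d' Tt' d'1 yE'; apply/esym/t_uniq; split=> //.
by exists d' => //; apply/pm1_in.
Qed.

Lemma pm1_neq0 (d : F) : d = 1 \/ d = -1 -> d != 0.
Proof. by case=> ->; rewrite ?oppr_eq0 oner_neq0. Qed.

Lemma quadratic_coord2_neq0 (p q : F) : p%:A + q *: r \notin 1%VS -> q != 0.
Proof.
by apply: contraNneq => ->; rewrite scale0r addr0; apply/vlineP; exists p.
Qed.

Lemma S2_orbit_reps : orbit_reps (S2_set r T).
Proof.
have [/subsetP T_sub _] := T_reps.
have rE k : k *: r = 0%:A + k *: r by rewrite scale0r add0r.
have sE (k s : F) : k *: (1 + s *: r) = k%:A + (k * s) *: r.
  by rewrite scalerDr scalerA.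
split=> [a [->|[s Ts ->]]|a]; first exact: r_notin.
  rewrite -[_ + _]scale1r sE mul1r; apply: quadratic_notin.
  by have := T_sub s Ts; rewrite inE.
have [p [q ->]] := quadratic_coords a => /quadratic_coord2_neq0 q0.
have [->|p0] := eqVneq p 0.
  exists r; split; first split; first by left.
    by exists 1%g, q; rewrite gal_id scale0r add0r.
  move=> b [[->//|[s Ts ->]] [rho [k]]].
  have [d /pm1_neq0 d0 ->] := quadratic_gal_coords rho 0 q.
  rewrite sE => /quadratic_coords_uniq[<-]; rewrite mul0r => /eqP.
  by rewrite mulf_eq0 (negPf d0) (negPf q0).
have [|t [Tt t0 [d d1 yE] t_uniq]] := @pm1_reps_unique (q / p).
  by rewrite mulf_neq0 ?invr_eq0.
have qE : q = p * (t * d) by rewrite -yE mulrC divfK.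
exists (1 + t *: r); split; first split; first by right; exists t.
  have [rho rhoE] := quadratic_sigma p q d1; exists rho, p; rewrite rhoE sE.
  by rewrite qE mulrCA [t * d]mulrC [d * (d * t)]mulrA pm1_sqr // mul1r.
move=> b [[->|[s Ts ->]] [rho [k]]].
  have [d' _ ->] := quadratic_gal_coords rho p q.
  by rewrite [k *: r]rE => /quadratic_coords_uniq[/eqP]; rewrite (negPf p0).
have [d' d1' ->] := quadratic_gal_coords rho p q.
rewrite sE => /quadratic_coords_uniq[<- qs]; congr (1 + _ *: r).
apply/esym/(t_uniq s d') => //; apply: (mulfI (pm1_neq0 d1')).
by rewrite mulrA qs mulrCA pm1_sqr // mulr1 mulrC mulKf.
Qed.

Lemma S2'_orbit_reps : orbit_reps (S2'_set r T).
Proof.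
have sE (k t : F) : k *: (t%:A + r) = (k * t)%:A + k *: r.
  by rewrite scalerDr scalerA.
split=> [a [t _ ->]|a].
  by rewrite -[_ + _]scale1r sE; apply: quadratic_notin; apply: oner_neq0.
have [p [q ->]] := quadratic_coords a => /quadratic_coord2_neq0 q0.
have key (rho : gal_of {:L}) (k t : F) : rho (p%:A + q *: r) = k *: (t%:A + r) ->
    exists2 d : F, d = 1 \/ d = -1 & p = q * (t * d).
  have [d d1 ->] := quadratic_gal_coords rho p q.
  rewrite sE => /quadratic_coords_uniq[-> <-]; exists d => //.
  by rewrite -mulrA mulrCA [d * t]mulrC.
have [p0|p0] := eqVneq p 0.
  exists (0%:A + r); split; first split.
  - by exists 0; rewrite ?setU11.
  - by exists 1%g, q; rewrite gal_id sE p0 mulr0.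
  move=> b [[t Tt ->] [rho [k /key[d /pm1_neq0 d0]]]]; rewrite p0 => /esym/eqP.
  by rewrite !mulf_eq0 (negPf q0) (negPf d0) orbF /= => /eqP->.
have [|t [Tt t0 [d d1 yE] t_uniq]] := @pm1_reps_unique (p / q).
  by rewrite mulf_neq0 ?invr_eq0.
have pE : p = q * (t * d) by rewrite -yE mulrC divfK.
exists (t%:A + r); split; first split; first by exists t; rewrite // setU1r.
  have [rho rhoE] := quadratic_sigma p q d1; exists rho, (d * q); rewrite rhoE sE.
  by rewrite [in LHS]pE; congr (_%:A + _); rewrite mulrA mulrC mulrA.
move=> b [[t' Tt' ->] [rho [k /key[d' d1' pE']]]].
have t'0 : t' != 0.
  by apply: contraNneq p0 => t'0; rewrite pE' t'0 mul0r mulr0.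
rewrite (t_uniq t' d') //; last by rewrite pE' mulrC mulKf.
by move: Tt'; rewrite in_setU1 (negPf t'0).
Qed.

End QuadraticRepresentatives.

(** * Representatives in the Kummer case *)

Section KummerRepresentatives.

Variables (F : finFieldType) (L : splittingFieldType F) (m : nat).
Variables (zeta b : F) (beta : L) (sigma0 : gal_of {:L}).
Variable T : forall I : {set 'I_m}, {set coefs F I}.
Hypothesis m_gt0 : (0 < m)%N.
Hypothesis prim_zeta : m.-primitive_root zeta.
Hypothesis dimL : \dim {:L} = m.
Hypothesis gen_sigma0 : generator 'Gal({:L} / 1%VS)%g sigma0.
Hypothesis b0 : b != 0.
Hypothesis beta_m : beta ^+ m = b%:A.
Hypothesis sigma0_beta : sigma0 beta = zeta *: beta.
Hypothesis T_reps : Delta_reps zeta T.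

Lemma beta_neq0 : beta != 0.
Proof.
apply: contraNneq b0 => beta0; move/eqP: beta_m.
by rewrite beta0 expr0n (negPf (lt0n_neq0 m_gt0)) eq_sym scaler_eq0 oner_eq0 orbF.
Qed.

Lemma zeta_neq0 : zeta != 0.
Proof.
apply/eqP => z0; have /eqP := prim_expr_order prim_zeta.
by rewrite z0 expr0n (negPf (lt0n_neq0 m_gt0)) eq_sym oner_eq0.
Qed.

Lemma iter_sigma0_beta s : iter s sigma0 beta = zeta ^+ s *: beta.
Proof.
elim: s => [|s IHs]; first by rewrite scale1r.
by rewrite iterS IHs linearZ /= sigma0_beta scalerA exprSr.
Qed.

Lemma sigma0_betaX s i : (sigma0 ^+ s)%g (beta ^+ i) = zeta ^+ (s * i) *: beta ^+ i.
Proof. by rewrite rmorphXn /= -iter_gal iter_sigma0_beta exprZn exprM. Qed.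

Definition beta_powers : m.-tuple L := [tuple beta ^+ i | i < m].

Lemma beta_powersE (i : 'I_m) : beta_powers`_i = beta ^+ i.
Proof. by rewrite -tnth_nth tnth_mktuple. Qed.

(** A relation of degree less than [m] satisfied by [beta] is satisfied by its
    [m] distinct conjugates [zeta^s beta]. *)
Lemma beta_powers_basis : basis_of {:L} beta_powers.
Proof.
rewrite basisEfree subvf size_tuple dimL leqnn !andbT.
apply/freeP => k sum0.
pose p := \poly_(i < m) (if insub i is Some j then (k j)%:A else 0) : {poly L}.
have pE x : p.[x] = \sum_i k i *: x ^+ i.
  by rewrite horner_poly; apply: eq_bigr => i _; rewrite valK mulr_algl.
have root_p s : root p (zeta ^+ s *: beta).
  rewrite rootE -iter_sigma0_beta iter_gal pE.
  rewrite (eq_bigr (fun i : 'I_m => (sigma0 ^+ s)%g (k i *: beta_powers`_i))).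
    by rewrite -linear_sum sum0 linear0.
  by move=> i _; rewrite beta_powersE linearZ /= rmorphXn.
have uniq_roots : uniq [seq zeta ^+ s *: beta | s <- iota 0 m].
  rewrite map_inj_in_uniq ?iota_uniq // => s t; rewrite !mem_iota !add0n /= => lt_s lt_t.
  move/eqP; rewrite -subr_eq0 -scalerBl scaler_eq0 (negPf beta_neq0) orbF subr_eq0.
  by rewrite (eq_prim_root_expr prim_zeta) !modn_small // => /eqP.
have p0 : p = 0.
  apply/eqP; apply: contraT => p0.
  have /(_ _)/= := max_poly_roots p0 _ uniq_roots; rewrite size_map size_iota.
  have -> : all (root p) [seq zeta ^+ s *: beta | s <- iota 0 m].
    by apply/allP => _ /mapP[s _ ->].
  by move=> /(_ isT); rewrite ltnNge size_poly.
move=> i; have /eqP : p`_i = 0 by rewrite p0 coef0.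
by rewrite coef_poly ltn_ord valK scaler_eq0 oner_eq0 orbF => /eqP.
Qed.

Local Notation bcoord i x := (coord beta_powers i x).

Lemma beta_coords x : x = \sum_i bcoord i x *: beta ^+ i.
Proof.
rewrite [LHS](coord_basis beta_powers_basis (memvf x)).
by apply: eq_bigr => i _; rewrite beta_powersE.
Qed.

Lemma bcoord_powers (i j : 'I_m) : bcoord i (beta ^+ j) = (j == i)%:R.
Proof.
by rewrite -beta_powersE coord_free ?(basis_free beta_powers_basis) // eq_sym.
Qed.

Lemma bcoord_inj x y : (forall i, bcoord i x = bcoord i y) -> x = y.
Proof.
by move=> e; rewrite [x]beta_coords [y]beta_coords; apply: eq_bigr => i _; rewrite e.
Qed.

Lemma bcoord_gal s x i :
  bcoord i ((sigma0 ^+ s)%g x) = zeta ^+ (s * i) * bcoord i x.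
Proof.
rewrite {1}[x]beta_coords !linear_sum (bigD1 i) //= big1 => [|j nji].
  by rewrite linearZ /= sigma0_betaX !linearZ /= bcoord_powers eqxx addr0 mulr1 mulrC.
by rewrite linearZ /= sigma0_betaX !linearZ /= bcoord_powers (negPf nji) !mulr0.
Qed.

Definition Kelt (I : {set 'I_m}) (u : coefs F I) : L :=
  beta ^+ elt I 0 + \sum_(j < #|I|.-1) u j *: beta ^+ elt I j.+1.

Let i0 : 'I_m := Ordinal m_gt0.

Definition eltI (I : {set 'I_m}) j : 'I_m := nth i0 (enum I) j.

Lemma eltIE (I : {set 'I_m}) j : (j < #|I|)%N -> elt I j = eltI I j.
Proof. by move=> lt_j; rewrite /elt (nth_map i0) // -cardE. Qed.

Lemma eltI_in (I : {set 'I_m}) j : (j < #|I|)%N -> eltI I j \in I.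
Proof. by move=> lt_j; rewrite -mem_enum mem_nth // -cardE. Qed.

Lemma eltI_eq (I : {set 'I_m}) j k : (j < #|I|)%N -> (k < #|I|)%N ->
  (eltI I j == eltI I k) = (j == k).
Proof. by move=> lt_j lt_k; rewrite nth_uniq ?enum_uniq -?cardE. Qed.

Lemma eltI_surj (I : {set 'I_m}) i : i \in I -> exists2 j, (j < #|I|)%N & i = eltI I j.
Proof.
move=> Ii; exists (index i (enum I)); first by rewrite cardE index_mem mem_enum.
by rewrite /eltI nth_index ?mem_enum.
Qed.

Section Support.

Variables (I : {set 'I_m}) (u : coefs F I).
Hypothesis I_gt0 : (0 < #|I|)%N.

Let lt_succ (j : 'I_#|I|.-1) : (j.+1 < #|I|)%N.
Proof. by rewrite -ltn_predRL. Qed.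

Lemma bcoord_Kelt i : bcoord i (Kelt u)
  = (eltI I 0 == i)%:R + \sum_(j < #|I|.-1) u j * (eltI I j.+1 == i)%:R.
Proof.
rewrite linearD linear_sum /= eltIE // bcoord_powers; congr (_ + _).
by apply: eq_bigr => j _; rewrite linearZ /= eltIE // bcoord_powers.
Qed.

Lemma bcoord_Kelt0 : bcoord (eltI I 0) (Kelt u) = 1.
Proof.
by rewrite bcoord_Kelt eqxx big1 ?addr0 // => j _; rewrite eltI_eq // mulr0.
Qed.

Lemma bcoord_KeltS (j : 'I_#|I|.-1) : bcoord (eltI I j.+1) (Kelt u) = u j.
Proof.
rewrite bcoord_Kelt eltI_eq // add0r (bigD1 j) //= eqxx mulr1 big1 ?addr0 // => k nkj.
by rewrite eltI_eq // eqSS (negPf (nkj : val k != val j)) mulr0.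
Qed.

Lemma bcoord_Kelt_out i : i \notin I -> bcoord i (Kelt u) = 0.
Proof.
move=> nIi; rewrite bcoord_Kelt; have ne j : (j < #|I|)%N -> (eltI I j == i) = false.
  by move=> lt_j; apply: contraNF nIi => /eqP<-; apply: eltI_in.
by rewrite ne // add0r big1 // => j _; rewrite ne ?mulr0.
Qed.

(** An element is recognised by its coefficients, at the first element of the
    support, at the other ones and outside. *)
Lemma Kelt_eq x k : bcoord (eltI I 0) x = k ->
  (forall j : 'I_#|I|.-1, bcoord (eltI I j.+1) x = k * u j) ->
  (forall i, i \notin I -> bcoord i x = 0) -> x = k *: Kelt u.
Proof.
move=> x0 xS xout; apply: bcoord_inj => i; rewrite linearZ /=.
have [/eltI_surj[[|j] lt_j ->]|nIi] := boolP (i \in I).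
- by rewrite x0 bcoord_Kelt0 mulr1.
- have lt_j' : (j < #|I|.-1)%N by rewrite ltn_predRL.
  by rewrite (xS (Ordinal lt_j')) (bcoord_KeltS (Ordinal lt_j')).
by rewrite xout // bcoord_Kelt_out // mulr0.
Qed.

Hypothesis u_unit : u \in coefs_units F I.

Lemma bcoord_Kelt_neq0 i : (bcoord i (Kelt u) != 0) = (i \in I).
Proof.
have [/eltI_surj[[|j] lt_j ->]|nIi] := boolP (i \in I).
- by rewrite bcoord_Kelt0 oner_neq0.
- have lt_j' : (j < #|I|.-1)%N by rewrite ltn_predRL.
  rewrite (bcoord_KeltS (Ordinal lt_j')).
  by move: u_unit; rewrite inE => /forallP->.
by rewrite bcoord_Kelt_out // eqxx.
Qed.

End Support.

(** The support of the element is [I] and its first coefficient is [k]. *)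
Lemma Kelt_inj (I J : {set 'I_m}) (u : coefs F I) (v : coefs F J) k l :
  (0 < #|I|)%N -> (0 < #|J|)%N -> u \in coefs_units F I -> v \in coefs_units F J ->
  k != 0 -> l != 0 -> k *: Kelt u = l *: Kelt v ->
  exists e : I = J, v = ecast I (coefs F I) e u.
Proof.
move=> I_gt0 J_gt0 u_unit v_unit k0 l0 e.
have coord_e i : k * bcoord i (Kelt u) = l * bcoord i (Kelt v).
  by have /(congr1 (fun x => bcoord i x)) := e; rewrite !linearZ.
have IJ : I = J.
  apply/setP => i; have /(congr1 (fun x => x != 0)) := coord_e i.
  by rewrite !mulf_eq0 (negPf k0) (negPf l0) !bcoord_Kelt_neq0.
case: J / IJ v J_gt0 v_unit e coord_e => v _ _ _ coord_e.
exists erefl; apply/ffunP=> j /=.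
have kl : k = l.
  by have := coord_e (eltI I 0); rewrite !bcoord_Kelt0 // !mulr1.
have := coord_e (eltI I j.+1); rewrite !bcoord_KeltS // kl.
by move/(mulfI l0).
Qed.

Definition root_weights (I : {set 'I_m}) s : coefs F I :=
  [ffun j : 'I_#|I|.-1 => zeta ^+ (s * (elt I j.+1 - elt I 0))].

(** The exponents run from 1 to [m] in [Delta], but only matter modulo [m]. *)
Lemma DeltaP (I : {set 'I_m}) d : d \in Delta zeta I <-> exists s, d = root_weights I s.
Proof.
split=> [/imsetP[s _ ->]|[s ->]]; first by exists s.+1.
have lt_s : ((s + m.-1) %% m < m)%N by rewrite ltn_mod.
apply/imsetP; exists (Ordinal lt_s) => //; apply/ffunP=> j; rewrite !ffunE /=.
apply/eqP; rewrite (eq_prim_root_expr prim_zeta); apply/eqP.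
rewrite -modnMml; apply/esym; rewrite -modnMml; congr ((_ * _) %% _)%N.
by rewrite -addn1 modnDml -addnA addn1 prednK // modnDr.
Qed.

(** The automorphism multiplies [beta^i] by [zeta^(s i)]; dividing by the factor
    of the first exponent leaves the weights of [Delta]. *)
Lemma sigma0_Kelt (I : {set 'I_m}) (u : coefs F I) s : (0 < #|I|)%N ->
  (sigma0 ^+ s)%g (Kelt u)
  = zeta ^+ (s * elt I 0) *: Kelt (coefs_mul u (root_weights I s)).
Proof.
move=> I_gt0; apply: Kelt_eq => //.
- by rewrite bcoord_gal bcoord_Kelt0 // mulr1 eltIE.
- move=> j; rewrite bcoord_gal bcoord_KeltS // !ffunE mulrCA mulrC; congr (_ * _).
  rewrite -exprD -mulnDr subnKC -?eltIE -?ltn_predRL //.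
  by rewrite ltnW // elt_incr //= -ltn_predRL.
by move=> i nIi; rewrite bcoord_gal bcoord_Kelt_out // mulr0.
Qed.

Lemma Kelt_notin1 (I : {set 'I_m}) (u : coefs F I) : u \in coefs_units F I ->
  I != set0 -> I != [set i : 'I_m | i == 0%N :> nat] -> Kelt u \notin 1%VS.
Proof.
rewrite -card_gt0 => u_unit I_gt0 nI; apply/negP => /vlineP[k Ku].
have I_0 i : i \in I -> i = 0%N :> nat.
  rewrite -(bcoord_Kelt_neq0 I_gt0 u_unit) Ku -[1](expr0 beta) linearZ /=.
  rewrite (bcoord_powers i i0); have [<-//|_] := eqVneq i0 i.
  by rewrite mulr0 eqxx.
case/negP: nI; apply/eqP/setP => i; rewrite inE; apply/idP/eqP => [/I_0//|i_0].
have Ie := eltI_in I_gt0.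
by have /val_inj<- : val (eltI I 0) = val i by rewrite [LHS](I_0 _ Ie) [RHS]i_0.
Qed.

Lemma Kelt_represents x : x \notin 1%VS -> exists I : {set 'I_m}, exists u : coefs F I,
  exists k : F, [/\ I != set0, I != [set i : 'I_m | i == 0%N :> nat],
    u \in coefs_units F I, k != 0 & x = k *: Kelt u].
Proof.
move=> nx; pose I := [set i | bcoord i x != 0].
have inI i : (i \in I) = (bcoord i x != 0) by rewrite inE.
have nI0 : I != set0.
  apply: contraNneq nx => I0; rewrite (_ : x = 0) ?mem0v //.
  apply: bcoord_inj => i; rewrite linear0; apply/eqP.
  by rewrite -[_ == _]negbK -inI I0 inE.
have I_gt0 : (0 < #|I|)%N by rewrite card_gt0.
pose k := bcoord (eltI I 0) x.
have k0 : k != 0 by rewrite -inI eltI_in.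
exists I, [ffun j : 'I_#|I|.-1 => bcoord (eltI I j.+1) x / k], k; split=> //.
- apply: contraNneq nx => I1; apply/vlineP; exists (bcoord i0 x).
  rewrite [LHS]beta_coords (bigD1 i0) //= expr0 big1 ?addr0 // => i ni.
  apply/eqP; rewrite scaler_eq0 -[_ == 0]negbK -inI I1 inE.
  rewrite (_ : (_ == _) = false) //; apply/negbTE.
  by apply: contra ni => /eqP i_0; apply/eqP/val_inj.
- rewrite inE; apply/forallP => j; rewrite ffunE mulf_neq0 ?invr_eq0 //.
  by rewrite -inI eltI_in // -ltn_predRL.
apply: Kelt_eq => // [j|i]; first by rewrite ffunE mulrC divfK.
by rewrite inI negbK => /eqP.
Qed.

Lemma S_set_orbit_reps : orbit_reps (S_set beta T).
Proof.
have T_unit I u : u \in T I -> u \in coefs_units F I.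
  by have [/subsetP sub _] := T_reps I; apply: sub.
split=> [_ [I [nI0 nI [u Tu ->]]]|x nx].
  by apply: Kelt_notin1 (T_unit _ _ Tu) nI0 nI.
have [I [u [k [nI0 nI u_unit k0 xE]]]] := Kelt_represents nx.
have I_gt0 : (0 < #|I|)%N by rewrite card_gt0.
have [_ /(_ u u_unit)[t [[Tt [_ /DeltaP[s ->] uE]] t_uniq]]] := T_reps I.
(* The weights for s = n and s = n (m - 1) are inverse to each other, since
   zeta^(n m) = 1. *)
have mulK (v : coefs F I) n :
  coefs_mul (coefs_mul v (root_weights I n)) (root_weights I (n * m.-1)) = v.
  apply/ffunP=> j; rewrite !ffunE -mulrA -exprD -mulnDl.
  rewrite -mulnS prednK // mulnAC exprM -exprM mulnC exprM.
  by rewrite (prim_expr_order prim_zeta) expr1n mulr1.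
exists (Kelt t); split; first split.
- by exists I; split=> //; exists t.
- pose n := (s * m.-1)%N; exists (sigma0 ^+ n)%g, (k * zeta ^+ (n * elt I 0)).
  by rewrite xE linearZ /= sigma0_Kelt // uE mulK scalerA.
move=> _ [[J [nJ0 nJ [v Tv ->]]] [rho [c]]].
have J_gt0 : (0 < #|J|)%N by rewrite card_gt0.
have [n _ ->] := gal_expg dimL gen_sigma0 rho; rewrite xE linearZ /= sigma0_Kelt //.
rewrite scalerA -/(Kelt v) => e.
have k'0 : k * zeta ^+ (n * elt I 0) != 0 by rewrite mulf_neq0 ?expf_neq0 ?zeta_neq0.
have w_unit : coefs_mul u (root_weights I n) \in coefs_units F I.
  rewrite inE; apply/forallP => j; rewrite !ffunE mulf_neq0 ?expf_neq0 ?zeta_neq0 //.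
  by move: u_unit; rewrite inE => /forallP.
have c0 : c != 0.
  apply: contraNneq (Kelt_notin1 w_unit nI0 nI) => c0; move/eqP: e.
  by rewrite c0 scale0r scaler_eq0 (negPf k'0) => /eqP->; apply: mem0v.
have [IJ] := Kelt_inj I_gt0 J_gt0 w_unit (T_unit _ _ Tv) k'0 c0 e.
case: J / IJ v Tv {nJ0 nJ J_gt0 e} => v Tv /= def_v; congr Kelt; apply: t_uniq.
split=> //; exists (root_weights I (n * m.-1)).
  by apply/DeltaP; exists (n * m.-1)%N.
by rewrite def_v mulK.
Qed.

End KummerRepresentatives.

(** * The classification *)

Theorem theorem6p3 :
  (* (i) *)
  (forall (F : finFieldType) (L : splittingFieldType F) (m : nat)
     (zeta b : F) (beta : L) (sigma0 : gal_of {:L})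
     (T : forall I : {set 'I_m}, {set coefs F I}),
   prime m -> odd m -> 2%N \notin [pchar F] -> m.-primitive_root zeta ->
   \dim {:L} = m ->
   generator 'Gal({:L} / 1%VS)%g sigma0 ->
   b != 0 -> (forall y : F, y ^+ m != b) ->
   splittingFieldFor 1%VS ('X^m - (b%:A)%:P) {:L} ->
   beta ^+ m = b%:A -> sigma0 beta = zeta *: beta ->
   Delta_reps zeta T ->
   let S := S_set beta T in
   (forall sigma : gal_of {:L}, generator 'Gal({:L} / 1%VS)%g sigma ->
      represents_classes (@linear_MRD_F F m) (@equiv_F F (m ^ 2))
        (@corresponds_F F L m sigma) S /\
      represents_classes (@linear_MRD_L F L m) (@equiv_L F L m)
        (@corresponds_L F L m sigma) S) /\
   separates_generators (@equiv_F F (m ^ 2)) (@corresponds_F F L m) S /\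
   separates_generators (@equiv_L F L m) (@corresponds_L F L m) S)
  /\
  (* (ii) *)
  (forall (F : finFieldType) (L : splittingFieldType F)
     (c : F) (r : L) (sigma : gal_of {:L}) (T : {set F}),
   c != 0 -> (forall y : F, y ^+ 2 != c) ->
   r ^+ 2 = c%:A -> \dim {:L} = 2%N -> <<1%VS; r>>%VS = {:L}%VS ->
   generator 'Gal({:L} / 1%VS)%g sigma ->
   pm1_reps T ->
   forall S : L -> Prop, S = S2_set r T \/ S = S2'_set r T ->
   represents_classes (@linear_MRD_F F 2) (@equiv_F F (2 ^ 2))
     (@corresponds_F F L 2 sigma) S /\
   represents_classes (@linear_MRD_L F L 2) (@equiv_L F L 2)
     (@corresponds_L F L 2 sigma) S).
Proof.
split=> [F L m zeta b beta sigma0 T pr_m _ _ prim_zeta dimL gen0 b0 _ _ beta_m s0_beta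
  T_reps S|F L c r sigma T _ nonsq r2 dimL _ gen T_reps S defS].
  have S_reps : orbit_reps S.
    exact: S_set_orbit_reps (prime_gt0 pr_m) prim_zeta dimL gen0 b0 beta_m s0_beta T_reps.
  split; last by apply: separates_generators_FL => //; apply: prime_gt1.
  by move=> sigma gen; apply: represents_classes_FL.
apply: represents_classes_FL => //; case: defS => ->.
  exact: S2_orbit_reps nonsq r2 dimL gen T_reps.
exact: S2'_orbit_reps nonsq r2 dimL gen T_reps.
Qed.
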